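(* Let $m\ge 2$, $\alpha\in\mathbb{C}$ with $\operatorname{Re}\alpha>0$, let $f$ be a measurable function on $\mathbb{R}^m$, and set $$\lambda=\frac{\pi^{(m-1)/2}\,\Gamma(\alpha/2)}{\Gamma((\alpha+m-1)/2)}.$$ Then the following equalities hold: $$\int_{\mathbb{R}^{m-1}\times\mathbb{R}} (R_T f)(a,b)\,\frac{|b|^{\alpha-1}\,da\,db}{(1+|a|^2)^{(\alpha+m-1)/2}}=\lambda\int_{\mathbb{R}^m} f(x)\,|x|^{\alpha-1}\,dx,$$ $$\int_{\mathbb{R}^{m-1}\times\mathbb{R}} (R_T f)(a,b)\,\frac{|b|^{\alpha-1}\,da\,db}{(1+|a|^2+b^2)^{(\alpha+m-1)/2}}=\lambda\int_{\mathbb{R}^m} f(x)\,\frac{|x|^{\alpha-1}}{(1+|x|^2)^{\alpha/2}}\,dx,$$ each provided that either side of the corresponding equality is finite (as a Lebesgue integral) when $f$ is replaced by $|f|$.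
   Context: Points of $\mathbb{R}^m$ are written $x=(x',x_m)$ with $x'\in\mathbb{R}^{m-1}$, $x_m\in\mathbb{R}$. The transversal Radon transform of a function $f$ on $\mathbb{R}^m$ is $$(R_T f)(a,b)=\int_{\mathbb{R}^{m-1}} f(x',\,a\cdot x'+b)\,dx',\qquad (a,b)\in\mathbb{R}^{m-1}\times\mathbb{R}.$$ *)

(* Defs.v *)
From HB Require Import structures.
From mathcomp Require Import all_boot all_order all_algebra.
From mathcomp Require Import all_classical all_reals all_analysis.
From mathcomp Require Import measurable_realfun.
From mathcomp Require Import complex.

Set Implicit Arguments.
Unset Strict Implicit.
Unset Printing Implicit Defensive.

Import Order.TTheory GRing.Theory Num.Theory.
Import numFieldNormedType.Exports.
Import ComplexField.Normc.

Local Open Scope classical_set_scope.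
Local Open Scope ring_scope.
Local Open Scope complex_scope.

Notation Rvec R n := (n.-tuple (measurableTypeR R)).

Section euclidean.
Variable R : realType.

Definition dot n (a x : Rvec R n) : R := \sum_(i < n) tnth a i * tnth x i.

Definition enorm n (x : Rvec R n) : R := Num.sqrt (dot x x).

(* (x', t) |-> x' followed by t: for m > 0 the default value t of nth is
   reached exactly at the last index m - 1. *)
Definition adjoin m (x' : Rvec R m.-1) (t : R) : Rvec R m :=
  [tuple nth t x' i | i < m].

End euclidean.

Section lebesgue_measure_vec.
Variable R : realType.

Fixpoint lebesgue_vec n : set (Rvec R n) -> \bar R :=
  match n with
  | 0 => dirac ([tuple] : Rvec R 0)
  | k.+1 => pushforward (lebesgue_vec (n := k) \x (@lebesgue_measure R))%E
              (fun p : Rvec R k * measurableTypeR R =>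
                 adjoin (m := k.+1) p.1 p.2)
  end.

Lemma measurable_adjoin m :
  measurable_fun [set: Rvec R m.-1 * measurableTypeR R]
    (fun p => adjoin (m := m) p.1 p.2).
Proof.
apply/measurable_fun_tnthP => i.
have [im|im] := ltnP i m.-1.
  rewrite (_ : _ \o _ = (fun x => tnth x (Ordinal im)) \o fst).
    by apply: measurableT_comp => //; exact: measurable_tnth.
  apply/funext => -[x t] /=.
  by rewrite tnth_mktuple (tnth_nth t).
rewrite (_ : _ \o _ = snd)//.
apply/funext => -[x t] /=.
by rewrite tnth_mktuple nth_default// size_tuple.
Qed.

Let sigma_finite_measureP d (T : measurableType d) (P : set T -> \bar R) :
    P set0 = 0%E -> (forall A, 0 <= P A)%E -> semi_sigma_additive P ->
    sigma_finite setT P ->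
  exists M : {sigma_finite_measure set T -> \bar R}, (M : set T -> \bar R) = P.
Proof.
move=> P0 Pge0 Psa Psf.
pose P1 := isMeasure.Build _ _ _ P P0 Pge0 Psa.
pose PM : {measure set T -> \bar R} := HB.pack P P1.
pose P2 := Measure_isSigmaFinite.Build _ _ _ PM Psf.
pose PS : {sigma_finite_measure set T -> \bar R} := HB.pack P P1 P2.
by exists PS.
Qed.

Let lebesgue_vecP n :
  exists M : {sigma_finite_measure set (Rvec R n) -> \bar R},
    (M : set (Rvec R n) -> \bar R) = lebesgue_vec (n := n).
Proof.
elim: n => [|n [M ME]].
  by exists (dirac ([tuple] : Rvec R 0)).
pose g (p : Rvec R n * measurableTypeR R) : Rvec R n.+1 :=
  adjoin (m := n.+1) p.1 p.2.
have mg : measurable_fun setT g by exact: (@measurable_adjoin n.+1).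
have mgV A : measurable A -> measurable (g @^-1` A).
  by move=> mA; rewrite -[X in measurable X]setTI; exact: mg.
pose h (y : Rvec R n.+1) : Rvec R n * measurableTypeR R :=
  ([tuple tnth y (widen_ord (leqnSn n) i) | i < n], tnth y ord_max).
have hgK p : h (g p) = p.
  case: p => x t; rewrite /h /g /=; congr pair.
    by apply: eq_from_tnth => i; rewrite !tnth_mktuple/= (tnth_nth t).
  by rewrite tnth_mktuple/= nth_default// size_tuple.
have mh : measurable_fun setT h.
  apply/measurable_fun_pairP; split.
    apply/measurable_fun_tnthP => i.
    rewrite (_ : _ \o _ = fun y => tnth y (widen_ord (leqnSn n) i)).
      exact: measurable_tnth.
    by apply/funext => y /=; rewrite tnth_mktuple.
  exact: measurable_tnth.
rewrite /= -ME; apply: sigma_finite_measureP.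
- by rewrite /pushforward preimage_set0 measure0.
- by move=> A; rewrite /pushforward; exact: measure_ge0.
- move=> F mF tF mUF; rewrite /pushforward preimage_bigcup.
  apply: measure_semi_sigma_additive.
  + by move=> k; exact: mgV.
  + apply/trivIsetP => /= i j _ _ ij; rewrite -preimage_setI.
    by move/trivIsetP : tF => -> //; rewrite preimage_set0.
  + by rewrite -preimage_bigcup; exact: mgV.
- have /sigma_finiteP[F [TF ndF Foo]] := sigma_finiteT M.
  have /sigma_finiteP[G [TG ndG Goo]] := sigma_finiteT (@lebesgue_measure R).
  exists (fun i => h @^-1` (F i `*` G i)).
    rewrite -preimage_bigcup; apply/esym; rewrite -subTset => y _ /=.
    have : setT (h y).1 by [].
    rewrite TF => -[i _ Fi].
    have : setT (h y).2 by [].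
    rewrite TG => -[j _ Gj].
    exists (maxn i j) => //; split.
      by move: Fi; exact/subsetPset/ndF/leq_maxl.
    by move: Gj; exact/subsetPset/ndG/leq_maxr.
  move=> i; have [mF Fi] := Foo i; have [mG Gi] := Goo i; split.
    by rewrite -[X in measurable X]setTI; apply: mh => //; exact: measurableX.
  rewrite /pushforward -comp_preimage.
  rewrite (_ : h \o _ = id); last by apply/funext => p; exact: hgK.
  by rewrite preimage_id product_measure1E// lte_mul_pinfty// ge0_fin_numE.
Qed.

Section instances.
Variable n : nat.
Notation leb := (lebesgue_vec (n := n)).

Let leb0 : leb set0 = 0%E.
Proof. by have [M <-] := lebesgue_vecP n. Qed.

Let leb_ge0 A : (0 <= leb A)%E.
Proof. by have [M <-] := lebesgue_vecP n. Qed.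

Let leb_semi_sigma_additive : semi_sigma_additive leb.
Proof.
have [M <-] := lebesgue_vecP n.
exact: measure_semi_sigma_additive.
Qed.

HB.instance Definition _ := isMeasure.Build _ _ _ leb
  leb0 leb_ge0 leb_semi_sigma_additive.

Let leb_sigma_finite : sigma_finite setT leb.
Proof.
have [M <-] := lebesgue_vecP n.
exact: sigma_finiteT.
Qed.

HB.instance Definition _ := Measure_isSigmaFinite.Build _ _ _ leb
  leb_sigma_finite.

End instances.

End lebesgue_measure_vec.

Arguments lebesgue_vec R n _ : clear implicits.

Section complex_integral.
Context d (T : measurableType d) (R : realType).
Variable mu : {measure set T -> \bar R}.
Implicit Types F : T -> R[i].

(* Measurability with respect to the mu-completion of the sigma-algebra of T;
   for mu = Lebesgue measure on the Borel sets, this is Lebesgue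
   measurability. *)
Definition completed_measurable_fun (g : T -> R) : Prop :=
  forall B : set (measurableTypeR R), measurable B ->
    completed_algebra_gen mu (g @^-1` B).

Definition cmeasurable F : Prop :=
  completed_measurable_fun (fun x => complex.Re (F x)) /\
  completed_measurable_fun (fun x => complex.Im (F x)).

Definition cintegrable F : Prop :=
  cmeasurable F /\ (\int[mu]_x (normc (F x))%:E < +oo)%E.

Definition cintegral (D : set T) F : R[i] :=
  (\int[mu]_(x in D) complex.Re (F x)) +i* (\int[mu]_(x in D) complex.Im (F x)).

End complex_integral.

Section special_functions.
Variable R : realType.
Implicit Types (x : R) (z : R[i]).

(* x ^ z = exp (z * ln x) for x > 0; at x = 0 the value is that of powR, i.e.
   0 if Re z != 0 and 1 if Re z = 0. *)
Definition cpow x z : R[i] :=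
  (x `^ complex.Re z)%:C *
  (cos (complex.Im z * ln x) +i* sin (complex.Im z * ln x)).

(* Euler's integral, meaningful for Re z > 0. *)
Definition cGamma z : R[i] :=
  cintegral (@lebesgue_measure R) `]0, +oo[
    (fun t => cpow t (z - 1) * (expR (- t))%:C).

Definition radon_lambda m (alpha : R[i]) : R[i] :=
  (pi `^ (m.-1%:R / 2))%:C * cGamma (alpha / 2)
    / cGamma ((alpha + m%:R - 1) / 2).

End special_functions.

Section transversal_radon.
Variables (R : realType) (m : nat).

Definition hyperplane_point (ab : Rvec R m.-1 * measurableTypeR R)
    (x' : Rvec R m.-1) : Rvec R m := adjoin x' (dot ab.1 x' + ab.2).

Definition RT (f : Rvec R m -> R[i]) (ab : Rvec R m.-1 * measurableTypeR R) :
    R[i] :=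
  cintegral (lebesgue_vec R m.-1) setT (fun x' => f (hyperplane_point ab x')).

(* R_T |f|, with values in [0, +oo]; RT itself would send a divergent integral
   to the junk value 0. *)
Definition RT_abs (f : Rvec R m -> R[i])
    (ab : Rvec R m.-1 * measurableTypeR R) : \bar R :=
  \int[lebesgue_vec R m.-1]_x' (normc (f (hyperplane_point ab x')))%:E.

End transversal_radon.

(* If int (R_T |f|) |u| or int |f| |w| is finite, then all the integrals in
     int (R_T f) u = c * int f w
   converge absolutely (the inner one, defining R_T f (a, b), for almost every
   (a, b)) and the equality holds. *)
Definition duality_identity (R : realType) (m : nat) (f : Rvec R m -> R[i])
    (c : R[i]) (u : Rvec R m.-1 * measurableTypeR R -> R[i])
    (w : Rvec R m -> R[i]) : Prop :=
  let mu := lebesgue_vec R m in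
  let nu := (lebesgue_vec R m.-1 \x @lebesgue_measure R)%E in
  (\int[nu]_ab (RT_abs f ab * (normc (u ab))%:E) < +oo)%E \/
  (\int[mu]_x (normc (f x * w x))%:E < +oo)%E ->
  [/\ {ae nu, forall ab, cintegrable (lebesgue_vec R m.-1)
                           (fun x' => f (hyperplane_point ab x'))},
      cintegrable nu (fun ab => RT f ab * u ab),
      cintegrable mu (fun x => f x * w x) &
      cintegral nu setT (fun ab => RT f ab * u ab) =
        c * cintegral mu setT (fun x => f x * w x)].

(* Main.v *)
(* By Tonelli applied to the incidence relation [x_m = a.x' + b], the pairing of
   [R_T f] with a weight [u] equals the pairing of [f] with
   [x |-> int u(a, x_m - a.x') da], so everything reduces to evaluating this
   kernel for
     u(a, b) = |b|^(alpha-1) / (1 + |a|^2 + eps b^2)^((alpha+m-1)/2),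
   with [eps = 0] and [eps = 1].  Let [h r = |r|^(alpha-1)], which is
   multiplicative, and integrate [h (y.x)] over [y] in [R^m] against
   [exp (- |y|^2 - eps (y.x)^2)].  In the coordinates [y = r (- a, 1)] the
   radial integral is [Gamma ((alpha+m-1)/2)] and the remaining one is the
   kernel; by rotation invariance the same integral is
   [pi^((m-1)/2) Gamma (alpha/2)] times the weight of [x].  Dividing by
   [Gamma ((alpha+m-1)/2)] requires that Gamma has no zero in the right
   half-plane.  A Lebesgue measurable [f] is first replaced by a Borel function
   equal to it almost everywhere; almost every hyperplane meets the exceptional
   set in a null set, again by Tonelli. *)

From HB Require Import structures.
Require Import Defs.
From mathcomp Require Import all_boot all_order all_algebra.
From mathcomp Require Import all_classical all_reals all_analysis.
From mathcomp Require Import measurable_realfun.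
From mathcomp Require Import complex.
From mathcomp Require Import ring lra.

Set Implicit Arguments.
Unset Strict Implicit.
Unset Printing Implicit Defensive.

Import Order.TTheory GRing.Theory Num.Theory.
Import numFieldNormedType.Exports.
Import ComplexField.Normc.
Import HBNNSimple.

Local Open Scope classical_set_scope.
Local Open Scope ring_scope.
Local Open Scope complex_scope.

(** * Integrals of almost everywhere equal functions *)

(** A direct evaluation of the kernel would integrate a quotient of complex powers over [a]. The
    Gaussian detour separates the geometry from the powers: [kernel_law] is an identity for every
    nonnegative Borel [g], so it involves no convergence question, and the exponent enters only when
    [g] is specialized. It is used twice. With the modulus of [h] it gives finiteness, with the
    constant [abs_kernel_constant], which is in general not the modulus of [radon_lambda]. With [h]
    itself, through positive and negative parts of the real and imaginary parts, it gives the
    complex identity; the finiteness just obtained then justifies Fubini. A divergent integral has a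
    junk value in [RT], so [RT f ab * u ab] can be manipulated only where [RT_abs f ab] is finite.
    This holds almost everywhere because the weighted integral of [RT_abs f] is finite and [u] is
    nonzero almost everywhere. That Gamma has no zero is a concentration argument: for large [s] the
    weight [t ^ (s - 1) * exp (- t)] is so narrow around [s], relative to its position, that the
    phase [y * ln t] hardly varies on it. *)

Lemma negligible_bigcup_countType d (T : measurableType d) (R : realType)
    (mu : {measure set T -> \bar R}) (J : countType) (F : J -> set T) :
  (forall i, mu.-negligible (F i)) -> mu.-negligible (\bigcup_i F i).
Proof.
move=> F0.
have : mu.-negligible (\bigcup_k (if @unpickle J k is Some i then F i else set0)).
  apply: negligible_bigcup => k; case: unpickle => // .
  exact: negligible_set0.
apply: negligibleS => x [i _ Fx]; exists (pickle i); first exact: I.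
by rewrite pickleK.
Qed.

Section ae_nonmeasurable.
Context d (T : measurableType d) (R : realType).
Variable mu : {measure set T -> \bar R}.
Local Open Scope ereal_scope.

(* [f] and [g] need not be measurable: a simple function below [f], cut off
   on [N], lies below [g]. *)
Lemma ge0_le_integral_off_null (f g : T -> \bar R) (N : set T) :
  measurable N -> mu N = 0 -> (forall x, 0 <= f x) -> (forall x, 0 <= g x) ->
  (forall x, ~ N x -> f x <= g x) -> \int[mu]_x f x <= \int[mu]_x g x.
Proof.
move=> mN N0 f0 g0 fg.
rewrite [leLHS]ge0_integralTE// [leRHS]ge0_integralTE//.
apply: ge_ereal_sup => _ [h /= hf] <-.
rewrite -integralT_nnsfun.
have -> : \int[mu]_x (h x)%:E = \int[mu]_x (proj_nnsfun h (measurableC mN) x)%:E.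
  apply: ae_eq_integral => //.
  - exact/measurable_EFinP.
  - exact/measurable_EFinP.
  - exists N; split => // x /=; apply: contra_notP => Nx _.
    by rewrite mindicE mem_set// mulr1.
rewrite integralT_nnsfun; apply: ereal_sup_ubound.
exists (proj_nnsfun h (measurableC mN)) => //= x; rewrite mindicE.
have [|] := boolP (x \in ~` N).
  by rewrite inE mulr1 => Nx; exact: le_trans (hf x) (fg _ Nx).
by rewrite mulr0.
Qed.

Lemma integral_eq_off_null (f g : T -> \bar R) (N : set T) :
  measurable N -> mu N = 0 -> (forall x, ~ N x -> f x = g x) ->
  \int[mu]_x f x = \int[mu]_x g x.
Proof.
move=> mN N0 fg; rewrite [LHS]integralE [RHS]integralE.
by congr (_ - _); apply/eqP; rewrite eq_le; apply/andP; split;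
  apply: (ge0_le_integral_off_null mN N0) => // x Nx;
  rewrite ?funeposE ?funenegE fg.
Qed.

Lemma eq_integral_ae (f g : T -> \bar R) :
  {ae mu, forall x, f x = g x} -> \int[mu]_x f x = \int[mu]_x g x.
Proof.
move=> [N [mN N0 fg]]; apply: (integral_eq_off_null mN N0) => x Nx.
by apply: contrapT => ne; apply: Nx; apply: fg.
Qed.

Lemma eq_Rintegral_ae (f g : T -> R) :
  {ae mu, forall x, f x = g x} -> (\int[mu]_x f x = \int[mu]_x g x)%R.
Proof.
move=> fg; rewrite /Rintegral; congr fine; apply: eq_integral_ae.
by apply: filterS fg => x ->.
Qed.

(** Off the null set the preimages under [f] and [g] coincide; what the preimage under [f] has
    inside it is negligible. *)
Lemma completed_measurable_fun_ae_eq (f g : T -> R) :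
  measurable_fun setT g -> {ae mu, forall x, f x = g x} ->
  completed_measurable_fun mu f.
Proof.
move=> mg [N [mN N0 fg]] B mB.
exists ((g @^-1` B) `\` N).
  by apply: measurableD => //; rewrite -[X in measurable X]setTI; exact: mg.
have fgE x : ~ N x -> f x = g x.
  by move=> Nx; apply: contrapT => ne; apply: Nx; apply: fg.
exists (f @^-1` B `&` N); first by exists N; split => // x [].
apply/seteqP; split => x /=.
  by case=> -[//] => gB Nx; rewrite fgE.
by move=> fB; have [Nx|Nx] := pselect (N x); [right|left; split => //; rewrite -fgE].
Qed.

(** Only the countably many preimages of the half-lines with rational endpoint matter. Off the union
    [N] of their exceptional null sets each of them is a Borel set, and these determine all
    preimages of half-lines; on [N] the function is reset to 0. *)
Lemma completed_measurable_fun_borel (f : T -> R) :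
  completed_measurable_fun mu f ->
  exists2 g : T -> R, measurable_fun setT g & {ae mu, forall x, f x = g x}.
Proof.
move=> mf.
have H (q : rat) : exists AN : set T * set T,
    [/\ measurable AN.1, measurable AN.2, mu AN.2 = 0 &
      forall x, ~ AN.2 x -> (AN.1 x <-> (ratr q < f x)%R)].
  have mq : measurable (`]ratr q, +oo[%classic : set (measurableTypeR R)).
    exact: measurable_itv.
  have [A mA [M [N [mN N0 MN]] AM]] := mf _ mq.
  exists (A, N); split => //= x Nx.
  have : (f @^-1` `]ratr q, +oo[) x <-> (ratr q < f x)%R.
    by rewrite /= in_itv/= andbT.
  rewrite -AM => E; split; first by move=> Ax; apply/E; left.
  by move/E => [//|Mx]; exfalso; apply: Nx; exact: MN.
have [AN ANP] := choice H.
pose N := \bigcup_q (AN q).2.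
have mN : measurable N.
  by apply: bigcupT_measurable_rat => q; have [] := ANP q.
have N0 : mu N = 0.
  apply/negligibleP => //; apply: negligible_bigcup_countType => q.
  by have [_ mB B0 _] := ANP q; apply/negligibleP.
have NE q x : ~ N x -> (AN q).1 x <-> (ratr q < f x)%R.
  move=> Nx; have [_ _ _] := ANP q; apply => Bx; apply: Nx.
  by exists q.
have [[x0 Nx0]|allN] := pselect (exists x, ~ N x); last first.
  exists (cst 0%R); first exact: measurable_cst.
  exists N; split => // x _.
  by apply: contrapT => Nx; apply: allN; exists x.
pose f0 : T -> R := (f \_ (~` N))%R; exists f0; last first.
  exists N; split => // x /=; apply: contra_notP => Nx.
  by rewrite /f0 patchE mem_set.
apply: (@measurability _ _ _ _ setT _ _ (RGenOInfty.measurableE R)) => // _ [_ [r ->] <-].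
rewrite setTI.
rewrite /f0.
(* The value on [N] is 0, so [N] belongs to the preimage exactly when [r] is negative. *)
have -> : (f \_ (~` N))%R @^-1` `]r, +oo[ =
    ((\bigcup_q (if (r < ratr q)%R then (AN q).1 else set0)) `&` ~` N) `|`
    (if (r < 0)%R then N else set0).
  apply/seteqP; split => x; rewrite /= in_itv/= andbT patchE.
    case: ifPn => [/set_mem Nx rfx|/negP Nx r0].
      left; split => //; have [q] := rat_in_itvoo rfx.
      rewrite in_itv/= => /andP[rq qf].
      by exists q; [exact: I|rewrite rq; apply/NE].
    right; rewrite r0; apply: contrapT => Nx'; apply: Nx; exact: mem_set.
  case=> [[[q _]]|].
    case: ifPn => // rq Aq Nx.
    by rewrite mem_set//; apply: lt_trans rq _; apply/NE.
  case: ifPn => // r0 Nx; rewrite memNset//=; exact.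
apply: measurableU; last by case: ifPn.
apply: measurableI; last exact: measurableC.
apply: bigcupT_measurable_rat => q; case: ifPn => // _.
by have [] := ANP q.
Qed.

End ae_nonmeasurable.

(** * Complex-valued functions *)

Section complex_algebra.
Variable R : realType.
Implicit Types (z : R[i]) (r : R).

Lemma complex_ReM z1 z2 : complex.Re (z1 * z2) =
  complex.Re z1 * complex.Re z2 - complex.Im z1 * complex.Im z2.
Proof. by case: z1 z2 => [a b] [c d]. Qed.

Lemma complex_ImM z1 z2 : complex.Im (z1 * z2) =
  complex.Re z1 * complex.Im z2 + complex.Im z1 * complex.Re z2.
Proof. by case: z1 z2 => [a b] [c d] /=. Qed.

Lemma complex_ReMr z r : complex.Re (z * r%:C) = complex.Re z * r.
Proof. by rewrite complex_ReM/= mulr0 subr0. Qed.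

Lemma complex_ImMr z r : complex.Im (z * r%:C) = complex.Im z * r.
Proof. by rewrite complex_ImM/= mulr0 add0r. Qed.

Lemma normc_real r : normc r%:C = `|r|.
Proof. by rewrite /= expr0n addr0 sqrtr_sqr. Qed.

Lemma normc_ge0 z : 0 <= normc z.
Proof. by case: z => a b /=; exact: sqrtr_ge0. Qed.

Lemma normRe_le z : `|complex.Re z| <= normc z.
Proof.
by case: z => a b /=; rewrite -sqrtr_sqr ler_wsqrtr// lerDl sqr_ge0.
Qed.

Lemma normIm_le z : `|complex.Im z| <= normc z.
Proof.
by case: z => a b /=; rewrite -sqrtr_sqr ler_wsqrtr// lerDr sqr_ge0.
Qed.

Lemma normc_le z : normc z <= `|complex.Re z| + `|complex.Im z|.
Proof.
case: z => a b /=; rewrite -[leRHS]ger0_norm ?addr_ge0// -sqrtr_sqr.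
rewrite ler_wsqrtr// sqrrD !real_normK ?num_real// lerD2r lerDl.
by rewrite mulrn_wge0// mulr_ge0.
Qed.

Lemma normc_gt0 z : z != 0 -> 0 < normc z.
Proof.
move=> z0; rewrite lt_neqAle normc_ge0 andbT eq_sym.
by apply: contra z0 => /eqP /eq0_normc ->.
Qed.

End complex_algebra.

Section complex_measurable.
Context d (T : measurableType d) (R : realType).
Implicit Types F G : T -> R[i].

(** The Borel counterpart of [cmeasurable]: unlike measurability for a completion, it is stable
    under composition with Borel maps and passes to sections. *)
Definition complex_measurable F :=
  measurable_fun setT (fun x => complex.Re (F x)) /\
  measurable_fun setT (fun x => complex.Im (F x)).

Lemma complex_measurableM F G : complex_measurable F -> complex_measurable G ->
  complex_measurable (fun x => F x * G x).
Proof.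
move=> [mF1 mF2] [mG1 mG2]; split.
  under eq_fun do rewrite complex_ReM.
  by apply: measurable_funB; apply: measurable_funM.
under eq_fun do rewrite complex_ImM.
by apply: measurable_funD; apply: measurable_funM.
Qed.

Lemma complex_measurable_real (g : T -> R) : measurable_fun setT g ->
  complex_measurable (fun x => (g x)%:C).
Proof. by split => //; exact: measurable_cst. Qed.

Lemma complex_measurable_normc F : complex_measurable F ->
  measurable_fun setT (fun x => normc (F x)).
Proof.
move=> [mF1 mF2].
rewrite (_ : (fun x => _) = fun x =>
    Num.sqrt (complex.Re (F x) ^+ 2 + complex.Im (F x) ^+ 2)).
  apply: (measurableT_comp (continuous_measurable_fun (@sqrt_continuous R))).
  by apply: measurable_funD; exact: measurable_funX.
by apply/funext => x; case: (F x).
Qed.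

End complex_measurable.

Lemma complex_measurable_comp d d' (T : measurableType d)
    (S : measurableType d') (R : realType) (phi : S -> T) (F : T -> R[i]) :
  measurable_fun setT phi -> complex_measurable F ->
  complex_measurable (F \o phi).
Proof.
move=> mphi [mF1 mF2]; split.
  exact: (measurableT_comp mF1 mphi).
exact: (measurableT_comp mF2 mphi).
Qed.

Section cintegral_lemmas.
Context d (T : measurableType d) (R : realType).
Variable mu : {measure set T -> \bar R}.
Implicit Types F G : T -> R[i].
Local Notation finite_norm F := (\int[mu]_x (normc (F x))%:E < +oo)%E.

Lemma cmeasurable_ae_eq F G : complex_measurable G ->
  {ae mu, forall x, F x = G x} -> cmeasurable mu F.
Proof.
move=> [mG1 mG2] FG; split.
  by apply: (completed_measurable_fun_ae_eq mG1); apply: filterS FG => x ->.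
by apply: (completed_measurable_fun_ae_eq mG2); apply: filterS FG => x ->.
Qed.

Lemma cmeasurable_borel F : cmeasurable mu F ->
  exists2 G, complex_measurable G & {ae mu, forall x, F x = G x}.
Proof.
move=> [/completed_measurable_fun_borel [g1 mg1 fg1]].
move=> /completed_measurable_fun_borel [g2 mg2 fg2].
exists (fun x => g1 x +i* g2 x) => //.
by apply: filterS2 fg1 fg2 => x <- <-; case: (F x).
Qed.

Lemma eq_cintegral_ae F G : {ae mu, forall x, F x = G x} ->
  cintegral mu setT F = cintegral mu setT G.
Proof.
move=> FG; rewrite /cintegral; congr (_ +i* _);
by apply: eq_Rintegral_ae; apply: filterS FG => x ->.
Qed.

Lemma eq_integral_normc_ae F G : {ae mu, forall x, F x = G x} ->
  (\int[mu]_x (normc (F x))%:E = \int[mu]_x (normc (G x))%:E)%E.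
Proof. by move=> FG; apply: eq_integral_ae; apply: filterS FG => x ->. Qed.

Lemma cintegrable_ae_eq F G : complex_measurable G -> finite_norm G ->
  {ae mu, forall x, F x = G x} -> cintegrable mu F.
Proof.
move=> mG Goo FG; split; first exact: cmeasurable_ae_eq FG.
by rewrite (eq_integral_normc_ae FG).
Qed.

Lemma integrable_Re F : complex_measurable F -> finite_norm F ->
  mu.-integrable setT (fun x => (complex.Re (F x))%:E).
Proof.
move=> mF Foo; have [mF1 mF2] := mF; apply/integrableP; split.
  exact/measurable_EFinP.
apply: le_lt_trans Foo; apply: ge0_le_integral => //.
- by apply/measurable_EFinP; exact: measurableT_comp.
- by apply/measurable_EFinP; exact: complex_measurable_normc.
- by move=> x _; rewrite lee_fin; exact: normRe_le.
Qed.

Lemma integrable_Im F : complex_measurable F -> finite_norm F ->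
  mu.-integrable setT (fun x => (complex.Im (F x))%:E).
Proof.
move=> mF Foo; have [mF1 mF2] := mF; apply/integrableP; split.
  exact/measurable_EFinP.
apply: le_lt_trans Foo; apply: ge0_le_integral => //.
- by apply/measurable_EFinP; exact: measurableT_comp.
- by apply/measurable_EFinP; exact: complex_measurable_normc.
- by move=> x _; rewrite lee_fin; exact: normIm_le.
Qed.

Lemma cintegralZl (c : R[i]) F : complex_measurable F -> finite_norm F ->
  cintegral mu setT (fun x => c * F x) = c * cintegral mu setT F.
Proof.
move=> mF Foo; have i1 := integrable_Re mF Foo; have i2 := integrable_Im mF Foo.
have iZ r (g : T -> R) : mu.-integrable setT (fun x => (g x)%:E) ->
    mu.-integrable setT (fun x => (r * g x)%:E).
  by move=> ig; have := integrableZl measurableT r ig.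
case: c => a b; rewrite /cintegral.
apply/eqP; rewrite eq_complex complex_ReM complex_ImM /=; apply/andP; split; apply/eqP.
  transitivity (\int[mu]_x (a * complex.Re (F x) - b * complex.Im (F x))).
    by apply: eq_Rintegral => x _; rewrite complex_ReM.
  by rewrite RintegralB ?RintegralZl//; exact: iZ.
transitivity (\int[mu]_x (a * complex.Im (F x) + b * complex.Re (F x))).
  by apply: eq_Rintegral => x _; rewrite complex_ImM.
by rewrite RintegralD ?RintegralZl//; exact: iZ.
Qed.

(** The crude factor 2 comes from bounding the real and imaginary parts separately; the estimate
    serves only to prove finiteness. *)
Lemma normc_cintegral_le F : complex_measurable F -> finite_norm F ->
  ((normc (cintegral mu setT F))%:E <= 2%:E * \int[mu]_x (normc (F x))%:E)%E.
Proof.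
move=> mF Foo; have i1 := integrable_Re mF Foo; have i2 := integrable_Im mF Foo.
have mN : measurable_fun setT (fun x => (normc (F x))%:E).
  by apply/measurable_EFinP; exact: complex_measurable_normc.
have [mF1 mF2] := mF.
rewrite (le_trans (y := (`|\int[mu]_x complex.Re (F x)| +
    `|\int[mu]_x complex.Im (F x)|)%:E))//.
  by rewrite lee_fin; exact: normc_le.
rewrite EFinD mule_natl mule2n; apply: leeD.
  rewrite EFin_normr_Rintegral//; apply: le_trans (le_abse_integral _ _ _) _ => //.
    exact/measurable_EFinP.
  apply: ge0_le_integral => //; first exact/measurableT_comp/measurable_EFinP.
  by move=> x _; rewrite lee_fin normRe_le.
rewrite EFin_normr_Rintegral//; apply: le_trans (le_abse_integral _ _ _) _ => //.
  exact/measurable_EFinP.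
apply: ge0_le_integral => //; first exact/measurableT_comp/measurable_EFinP.
by move=> x _; rewrite lee_fin normIm_le.
Qed.

End cintegral_lemmas.

(** * Fubini for complex-valued integrals *)

Section cintegral_fubini.
Context d1 d2 (T1 : measurableType d1) (T2 : measurableType d2) (R : realType).
Variable m1 : {sigma_finite_measure set T1 -> \bar R}.
Variable m2 : {sigma_finite_measure set T2 -> \bar R}.

Lemma Rintegral_fubini1 (f : T1 * T2 -> R) :
  (m1 \x m2)%E.-integrable setT (fun z => (f z)%:E) ->
  \int[m1]_x \int[m2]_y f (x, y) = \int[(m1 \x m2)%E]_z f z.
Proof.
move=> fi; rewrite /Rintegral -integral12_prod_meas1//; congr fine.
(* The inner integral passes through [fine], which leaves its value intact only on the integrable
   sections, hence almost everywhere. *)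
apply: eq_integral_ae; apply: filterS (ae_integrable1 fi) => x /= fx.
by rewrite fineK//; exact: integrable_fin_num.
Qed.

Lemma cintegral_fubini1 (F : T1 * T2 -> R[i]) : complex_measurable F ->
  (\int[m1]_x \int[m2]_y (normc (F (x, y)))%:E < +oo)%E ->
  cintegral m1 setT (fun x => cintegral m2 setT (fun y => F (x, y))) =
  cintegral (m1 \x m2)%E setT F.
Proof.
move=> mF Foo; have mN := complex_measurable_normc mF.
rewrite -(fubini_tonelli1 (fun z => (normc (F z))%:E)) in Foo; last 2 first.
- exact/measurable_EFinP.
- by move=> z; rewrite lee_fin normc_ge0.
rewrite /cintegral; congr (_ +i* _) => /=.
  exact: Rintegral_fubini1 (integrable_Re mF Foo).
exact: Rintegral_fubini1 (integrable_Im mF Foo).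
Qed.

(** Integrability is not involved: each part is [fine] of a difference of two Tonelli integrals,
    measurable also where the value is junk. This is what makes [RT f] measurable everywhere. *)
Lemma complex_measurable_cintegral (F : T1 * T2 -> R[i]) :
  complex_measurable F ->
  complex_measurable (fun x => cintegral m2 setT (fun y => F (x, y))).
Proof.
have mR (f : T1 * T2 -> R) : measurable_fun setT f ->
    measurable_fun setT (fun x => \int[m2]_y f (x, y)).
  move=> mf.
  have mfE : measurable_fun setT (fun z => (f z)%:E) by exact/measurable_EFinP.
  rewrite (_ : (fun x => _) = fine \o
      ((fun x => \int[m2]_y (fun z => (f z)%:E)^\+ (x, y)) \-
       (fun x => \int[m2]_y (fun z => (f z)%:E)^\- (x, y)))%E); last first.
    apply/funext => x /=; rewrite /Rintegral integralE.
    by congr (fine (_ - _)); apply: eq_integral => y _;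
      rewrite ?funeposE ?funenegE.
  apply: measurableT_comp => //.
  apply: emeasurable_funB; apply: measurable_fun_fubini_tonelli_F => //.
    exact: measurable_funepos.
  exact: measurable_funeneg.
by move=> [mF1 mF2]; split; [exact: mR mF1|exact: mR mF2].
Qed.

End cintegral_fubini.

(** * From nonnegative identities to complex ones *)

Section transfer.
Context dX dY dU (X : measurableType dX) (Y : measurableType dY)
  (U : measurableType dU) (R : realType).
Variables (mu : {measure set X -> \bar R}) (nu : {measure set Y -> \bar R}).
Variables (phi : X -> U) (psi : Y -> U) (v : X -> R) (w : Y -> R).
Hypotheses (v0 : forall x, 0 <= v x) (w0 : forall y, 0 <= w y).
Hypothesis phi_psi : forall g : U -> \bar R, measurable_fun setT g ->
  (forall u, 0 <= g u)%E ->
  (\int[mu]_x (g (phi x) * (v x)%:E) = \int[nu]_y (g (psi y) * (w y)%:E))%E.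

(** A nonnegative weight commutes with taking positive and negative parts, so [phi_psi] applies to
    both parts of [h]. The two sides then agree even when they diverge, since they are built from
    the same pair of extended reals. *)
Lemma Rintegral_transfer (h : U -> R) : measurable_fun setT h ->
  \int[mu]_x (h (phi x) * v x) = \int[nu]_y (h (psi y) * w y).
Proof.
move=> mh; have mhE : measurable_fun setT (EFin \o h) by exact/measurable_EFinP.
rewrite /Rintegral; congr fine; rewrite [LHS]integralE [RHS]integralE.
have pE (a r : R) : 0 <= r ->
    (maxe (a * r)%:E 0 = maxe a%:E 0 * r%:E)%E.
  by move=> r0; rewrite -!EFin_max -EFinM maxr_pMl// mul0r.
congr (_ - _)%E.
  have := phi_psi (measurable_funepos mhE) (funepos_ge0 _).
  under eq_integral do rewrite funeposE/= -pE//.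
  under [RHS]eq_integral do rewrite funeposE/= -pE//.
  move=> H; under eq_integral do rewrite funeposE/=.
  by rewrite H; under [RHS]eq_integral do rewrite funeposE/=.
have := phi_psi (measurable_funeneg mhE) (funeneg_ge0 _).
under eq_integral do rewrite funenegE/= -pE// mulNr.
under [RHS]eq_integral do rewrite funenegE/= -pE// mulNr.
move=> H; under eq_integral do rewrite funenegE/=.
by rewrite H; under [RHS]eq_integral do rewrite funenegE/=.
Qed.

Lemma cintegral_transfer (h : U -> R[i]) : complex_measurable h ->
  cintegral mu setT (fun x => h (phi x) * (v x)%:C) =
  cintegral nu setT (fun y => h (psi y) * (w y)%:C).
Proof.
move=> [mh1 mh2]; rewrite /cintegral; congr (_ +i* _).
  under eq_Rintegral do rewrite complex_ReMr.
  by under [RHS]eq_Rintegral do rewrite complex_ReMr; exact: Rintegral_transfer mh1.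
under eq_Rintegral do rewrite complex_ImMr.
by under [RHS]eq_Rintegral do rewrite complex_ImMr; exact: Rintegral_transfer mh2.
Qed.

End transfer.

(** * Changes of variable on the line *)

Section change_of_variables.
Variable R : realType.
Local Notation lam := (@lebesgue_measure R).

Lemma integral_is_derive (f F : R -> R) (a b : R) : a <= b ->
  (forall x, a <= x <= b -> is_derive x 1 F (f x)) ->
  (forall x, a <= x <= b -> {for x, continuous f}) ->
  (\int[lam]_(x in `[a, b]) (f x)%:E = (F b - F a)%:E)%E.
Proof.
rewrite le_eqVlt => /predU1P[<- _ _|ab dF cf].
  by rewrite set_itv1 integral_set1 subrr.
have cF x : a <= x <= b -> {for x, continuous F}.
  move=> /dF dFx; apply/differentiable_continuous/derivable1_diffP.
  exact: ex_derive.
rewrite EFinB; apply: continuous_FTC2 => //.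
- apply: continuous_in_subspaceT => x; rewrite inE/= in_itv/=; exact: cf.
- split.
  + move=> x; rewrite in_itv/= => /andP[ax xb].
    by have /@ex_derive := dF x (introT andP (conj (ltW ax) (ltW xb))).
  + by apply/cvg_at_right_filter; apply: cF; rewrite lexx ltW.
  + by apply/cvg_at_left_filter; apply: cF; rewrite lexx ltW.
- move=> x; rewrite in_itv/= => /andP[ax xb].
  by rewrite derive1E; have /@derive_val := dF x (introT andP (conj (ltW ax) (ltW xb))).
Qed.

Section density.
Variables (F : measurableTypeR R -> measurableTypeR R) (w : measurableTypeR R -> R).
Hypotheses (mF : measurable_fun setT F) (mw : measurable_fun setT w).
Hypothesis w0 : forall r, 0 <= w r.
Hypothesis Fw : forall a b : R, a <= b ->
  (\int[lam]_(r in F @^-1` `]a, b]) (w r)%:E = (b - a)%:E)%E.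

Let mpre (A : set (measurableTypeR R)) : measurable A ->
  measurable (F @^-1` A : set (measurableTypeR R)).
Proof. by move=> mA; rewrite -[X in measurable X]setTI; exact: mF. Qed.

Let mwE D : measurable_fun D (fun r : R => (w r)%:E).
Proof. exact/measurable_EFinP/measurable_funTS. Qed.

Let nu (A : set (measurableTypeR R)) : \bar R :=
  (\int[lam]_(r in F @^-1` A) (w r)%:E)%E.

(** [nu] is a measure that agrees with Lebesgue measure on half-open intervals, and these determine
    Lebesgue measure. *)
Let lebesgue_density (A : set (measurableTypeR R)) : measurable A ->
  lam A = nu A.
Proof.
have nu0 : nu set0 = 0%E by rewrite /nu preimage_set0 integral_set0.
have nuge0 B : (0 <= nu B)%E by apply: integral_ge0 => x _; rewrite lee_fin.
have nusa : semi_sigma_additive nu.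
  move=> B mB tB mUB.
  have -> : nu (\bigcup_k B k) = (\sum_(i <oo) nu (B i))%E.
    rewrite /nu preimage_bigcup ge0_integral_bigcup//.
    - by move=> k; exact: mpre.
    - exact: mwE.
    - by move=> x _; rewrite lee_fin.
    - apply/trivIsetP => i j _ _ ij; rewrite -preimage_setI.
      by move/trivIsetP : tB => -> //; rewrite preimage_set0.
  by apply: cvg_toP => //; apply: is_cvg_ereal_nneg_natsum => n _; exact: nuge0.
pose p := isMeasure.Build _ _ _ nu nu0 nuge0 nusa.
pose nuM : {measure set (measurableTypeR R) -> \bar R} := HB.pack nu p.
move=> mA; apply: (@lebesgue_measure_unique _ nuM) => // X [[a b]] _ <- /=.
have [ab|ba] := ltP a b.
  rewrite /nuM/= /nu Fw ?(ltW ab)// lebesgue_measure_itv/= lte_fin ab.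
  by rewrite -EFinB.
by rewrite set_itv_ge ?bnd_simp -?leNgt// measure0; exact/esym/nu0.
Qed.

(** [F] carries the measure with density [w] to Lebesgue measure; this settles simple functions, and
    monotone convergence does the rest. Prescribing the weight of preimages of intervals, instead of
    a derivative, suits affine maps and the map [r * |r|] alike. *)
Lemma ge0_integral_density (g : measurableTypeR R -> \bar R) :
  measurable_fun setT g -> (forall r, 0 <= g r)%E ->
  (\int[lam]_r g r = \int[lam]_r (g (F r) * (w r)%:E))%E.
Proof.
move=> mg g0; pose g_ := nnsfun_approx measurableT mg.
have gnE n x : (0 <= (g_ n (F x))%:E * (w x)%:E)%E.
  by rewrite -EFinM lee_fin mulr_ge0.
have mgn n : measurable_fun setT (fun x => (g_ n (F x))%:E * (w x)%:E)%E.
  apply: emeasurable_funM; apply/measurable_EFinP; last exact: mw.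
  exact: (measurableT_comp (measurable_funPT (g_ n)) mF).
transitivity (limn (fun n => \int[lam]_r (g_ n r)%:E))%E.
  rewrite -monotone_convergence//.
  - apply: eq_integral => y _; apply/esym/cvg_lim => //.
    by apply: cvg_nnsfun_approx => // *; exact: g0.
  - by move=> n; exact/measurable_EFinP.
  - by move=> n y _; rewrite lee_fin.
  - by move=> y _ m n mn; rewrite lee_fin; exact/lefP/nd_nnsfun_approx.
transitivity (limn (fun n => \int[lam]_r ((g_ n (F r))%:E * (w r)%:E)))%E; last first.
  rewrite -monotone_convergence//.
  - apply: eq_integral => y _; apply/cvg_lim => //.
    apply: cvgeZr => //; apply: cvg_nnsfun_approx => // *; exact: g0.
  - move=> y _ m n mn; rewrite lee_wpmul2r ?lee_fin//.
    exact/lefP/nd_nnsfun_approx.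
congr (limn _); apply/funext => n.
have gE r : (g_ n r)%:E = (\sum_(k \in range (g_ n))
    (k * \1_(g_ n @^-1` [set k]) r)%:E)%E.
  by rewrite fimfunE -fsumEFin.
have k1_ge0 k r : 0 <= k * \1_(g_ n @^-1` [set k]) r.
  rewrite indicE; have [|_] := boolP (r \in _); last by rewrite mulr0.
  by rewrite inE mulr1 => <-.
have mpreg k : measurable (g_ n @^-1` [set k] : set (measurableTypeR R)) by [].
transitivity (\sum_(k \in range (g_ n)) k%:E * nu (g_ n @^-1` [set k]))%E.
  rewrite integralT_nnsfun sintegralE; apply: eq_fsbigr => k _.
  by congr (_ * _)%E; exact: lebesgue_density.
transitivity (\sum_(k \in range (g_ n)) \int[lam]_r
    ((k * \1_(g_ n @^-1` [set k]) (F r))%:E * (w r)%:E))%E.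
  apply: eq_fsbigr => k /[!inE] -[y _ gk].
  have k0 : 0 <= k by rewrite -gk.
  have mr := (measurable_restrictT (fun r : measurableTypeR R => (w r)%:E)
    (mpre (mpreg k))).1 (@mwE _).
  rewrite /nu integral_mkcond -ge0_integralZl//; last first.
    by move=> x _; apply: erestrict_ge0 => z _; rewrite lee_fin.
  apply: eq_integral => x _; rewrite patchE indicE.
  have -> : (x \in F @^-1` (g_ n @^-1` [set k])) = (F x \in g_ n @^-1` [set k]).
    by [].
  by case: (F x \in _); rewrite ?mulr1 ?mulr0 ?mul0e ?mule0.
rewrite -ge0_integral_fsum//; last 2 first.
- move=> k; apply: emeasurable_funM; apply/measurable_EFinP; last exact: mw.
  apply: measurable_funM => //.
  exact: (measurableT_comp (measurable_indic _) mF).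
- by move=> k x _; rewrite -EFinM lee_fin mulr_ge0.
apply: eq_integral => x _; rewrite gE; apply/esym/ge0_mule_fsuml.
by move=> k; rewrite lee_fin.
Qed.

End density.

Lemma ge0_integral_affine (c d : R) (g : measurableTypeR R -> \bar R) :
  c != 0 -> measurable_fun setT g -> (forall r, 0 <= g r)%E ->
  (\int[lam]_r (g (c * r + d)%R * (`|c|)%:E) = \int[lam]_r g r)%E.
Proof.
move=> c0 mg g0; apply/esym.
apply: (@ge0_integral_density (fun r => c * r + d) (fun=> `|c|)) => //.
  by apply: measurable_funD => //; exact: measurable_funM.
move=> a b ab; have mitv (i : interval R) :
    measurable ([set` i] : set (measurableTypeR R)) by exact: measurable_itv.
have [cp|cn|/eqP] := ltgtP 0 c; last by rewrite eq_sym (negbTE c0).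
  have -> : (fun r : R => c * r + d) @^-1` `]a, b] = `](a - d) / c, (b - d) / c]%classic.
    apply/seteqP; split => r; rewrite /= !in_itv/=.
      by rewrite ltr_pdivrMr// ler_pdivlMr// ltrBlDr lerBrDr mulrC.
    by rewrite ltr_pdivrMr// ler_pdivlMr// ltrBlDr lerBrDr mulrC.
  rewrite integral_cst//= lebesgue_measure_itv/= lte_fin ltr_pM2r ?invr_gt0//.
  rewrite ltrD2r; case: ltgtP ab => // [ab _|-> _]; last by rewrite mule0 subrr.
  rewrite -EFinB -EFinM gtr0_norm//; congr (_%:E); field.
  by rewrite gt_eqF.
(* A negative slope exchanges the closed and the open end. *)
have -> : (fun r : R => c * r + d) @^-1` `]a, b] = `[(b - d) / c, (a - d) / c[%classic.
  apply/seteqP; split => r; rewrite /= !in_itv/= andbC.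
    by rewrite ler_ndivrMr// ltr_ndivlMr// ltrBlDr lerBrDr mulrC.
  by rewrite ler_ndivrMr// ltr_ndivlMr// ltrBlDr lerBrDr mulrC.
rewrite integral_cst//= lebesgue_measure_itv/= lte_fin ltr_nM2r ?invr_lt0//.
rewrite ltrD2r; case: ltgtP ab => // [ab _|-> _]; last by rewrite mule0 subrr.
rewrite -EFinB -EFinM ltr0_norm//; congr (_%:E); field.
by rewrite lt_eqF.
Qed.

(** [r * |r|] is an antiderivative of [2 * |r|]; it is [r ^ 2] or [- r ^ 2] on either side of 0,
    where the interval is cut. *)
Lemma integral_norm_itv (a b : R) : a <= b ->
  (\int[lam]_(r in `]a, b]) (2 * `|r|)%:E = (b * `|b| - a * `|a|)%:E)%E.
Proof.
have m2 (D : set (measurableTypeR R)) :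
    measurable_fun D (fun r : measurableTypeR R => (2 * `|r|)%:E).
  apply/measurable_funTS/measurable_EFinP; apply: measurable_funM;
    [exact: measurable_cst|exact: normr_measurable].
have pos (x y : R) : 0 <= x -> x <= y ->
    (\int[lam]_(r in `]x, y]) (2 * `|r|)%:E = (y * `|y| - x * `|x|)%:E)%E.
  move=> x0 xy; rewrite integral_itv_obnd_cbnd; last exact: m2.
  rewrite (eq_integral (fun r : measurableTypeR R => (2 * r)%:E)); last first.
    move=> r; rewrite inE/= in_itv/= => /andP[xr _].
    by rewrite ger0_norm// (le_trans x0).
  apply: (etrans (@integral_is_derive (fun r => 2 * r) (fun r => r ^+ 2)
      _ _ xy _ _)).
  - by move=> r _; apply: is_derive_eq; rewrite scaler1; ring.
  - by move=> r _; apply: cvgM; [exact: cvg_cst|exact: cvg_id].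
  - by rewrite !ger0_norm// (le_trans x0).
have neg (x y : R) : x <= y -> y <= 0 ->
    (\int[lam]_(r in `]x, y]) (2 * `|r|)%:E = (y * `|y| - x * `|x|)%:E)%E.
  move=> xy y0; rewrite integral_itv_obnd_cbnd; last exact: m2.
  rewrite (eq_integral (fun r : measurableTypeR R => (- (2 * r))%:E)); last first.
    move=> r; rewrite inE/= in_itv/= => /andP[_ ry].
    by rewrite ler0_norm ?mulrN// (le_trans ry).
  apply: (etrans (@integral_is_derive (fun r => - (2 * r)) (fun r => - r ^+ 2)
      _ _ xy _ _)).
  - by move=> r _; apply: is_derive_eq; rewrite scaler1; ring.
  - by move=> r _; apply: cvgN; apply: cvgM; [exact: cvg_cst|exact: cvg_id].
  - by rewrite !ler0_norm ?(le_trans xy)//; congr (_%:E); ring.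
move=> ab; have [a0|a0] := leP 0 a; first exact: pos.
have [b0|b0] := leP b 0; first exact: neg.
rewrite (@itv_bndbnd_setU _ _ _ (BRight 0))//= ?bnd_simp ?ltW//.
rewrite ge0_integral_setU//=.
- rewrite (neg _ _ (ltW a0) (lexx 0)) (pos _ _ (lexx 0) (ltW b0)) -EFinD.
  by congr (_%:E); ring.
- apply/disj_setPS => x [] /=; rewrite !in_itv/= => /andP[_ x0] /andP[x1 _].
  by move: (lt_le_trans x1 x0); rewrite ltxx.
Qed.

(** Squaring is two-to-one, so the bijection [r * |r|] of the line is used instead, on the even
    function [g |r|]. Its integral is computed once by symmetry and once by this substitution; both
    results carry a factor 2, which cancels. *)
Lemma ge0_integral_sqr (g : measurableTypeR R -> \bar R) :
  measurable_fun setT g -> (forall r, 0 <= g r)%E ->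
  (\int[lam]_r (g (r ^+ 2)%R * (`|r|)%:E) = \int[lam]_(r in `]0%R, +oo[) g r)%E.
Proof.
move=> mg g0.
have mabs : measurable_fun setT (fun r : measurableTypeR R => `|r| : measurableTypeR R).
  exact: normr_measurable.
have msqr : measurable_fun setT (fun r : measurableTypeR R => r ^+ 2 : measurableTypeR R).
  exact: measurable_funX.
have mga : measurable_fun setT (fun r : measurableTypeR R => g `|r|%R).
  exact: (measurableT_comp mg mabs).
have half : (\int[lam]_r g `|r|%R = 2%:E * \int[lam]_(r in `]0%R, +oo[) g r)%E.
  rewrite -(setUv `[0, +oo[%classic) ge0_integral_setU//=; last 3 first.
  - exact: measurableC.
  - by rewrite setUv.
  - exact/disj_setPCl.
  rewrite setCitvr integral_itv_bndo_bndc; last exact: measurable_funTS.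
  rewrite (ge0_integration_by_substitution0 mga)//.
  under [X in (_ + X)%E]eq_integral do rewrite -normrN.
  rewrite -(ge0_integration_by_substitution0 mga)//.
  have -> : (\int[lam]_(r in `]0%R, +oo[) g r = \int[lam]_(r in `[0%R, +oo[) g `|r|%R)%E.
    rewrite integral_itv_obnd_cbnd; last exact: measurable_funTS.
    apply: eq_integral => r; rewrite inE/= in_itv/= andbT => r0.
    by rewrite ger0_norm.
  by rewrite mule_natl mule2n.
have := @ge0_integral_density (fun r => r * `|r|) (fun r => 2 * `|r|).
move=> /(_ _ _ _ _ (fun r => g `|r|%R)) => H.
have {H}: (\int[lam]_r g `|r|%R = 2%:E * \int[lam]_r (g (r ^+ 2)%R * (`|r|)%:E))%E.
  rewrite H//.
  - rewrite -ge0_integralZl//; last 2 first.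
    + apply: emeasurable_funM; first exact: (measurableT_comp mg msqr).
      exact/measurable_EFinP.
    + by move=> r _; rewrite mule_ge0.
    apply: eq_integral => r _; rewrite EFinM muleCA; congr (_ * (g _ * _))%E.
    by rewrite normrM normr_id -expr2 real_normK ?num_real.
  - exact: measurable_funM.
  - exact: measurable_funM.
  - move=> a b ab.
    (* The signed square root, inverse to [r * |r|]. *)
    pose G (x : R) := Num.sg x * Num.sqrt `|x|.
    have GE x : G x * `|G x| = x.
      rewrite /G normrM [`|Num.sqrt _|]ger0_norm ?sqrtr_ge0// mulrACA.
      rewrite -expr2 sqr_sqrtr// normr_sg.
      have [->|x0] := eqVneq x 0; first by rewrite sgr0 !mul0r.
      by rewrite mulr1 -numEsg.
    have Finc (x y : R) : (x * `|x| < y * `|y|) = (x < y).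
      by case: (ger0P x) => x0; case: (ger0P y) => y0; apply/idP/idP; nra.
    have -> : (fun r : R => r * `|r|) @^-1` `]a, b] = `]G a, G b]%classic.
      apply/seteqP; split => r; rewrite /= !in_itv/=.
        by rewrite -[X in X < _](GE a) -[X in _ <= X](GE b) !leNgt !Finc.
      by rewrite -[X in X < _ * _](GE a) -[X in _ * _ <= X](GE b) !leNgt !Finc.
    rewrite integral_norm_itv ?GE//.
    by rewrite leNgt -Finc !GE -leNgt.
rewrite half => /(congr1 (fun x => (2^-1)%:E * x)%E).
by rewrite !muleA -!EFinM mulVf// !mul1e => ->.
Qed.

End change_of_variables.

(** * Vectors *)

Section vectors.
Variable R : realType.
Local Notation RR := (measurableTypeR R).
Local Notation lam := (@lebesgue_measure R).
Implicit Types n : nat.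

Lemma tnth_adjoin_lift n (x : Rvec R n) (t : RR) (i : 'I_n) :
  tnth (adjoin (m := n.+1) x t) (widen_ord (leqnSn n) i) = tnth x i.
Proof. by rewrite tnth_mktuple/= (tnth_nth t). Qed.

Lemma tnth_adjoin_max n (x : Rvec R n) (t : RR) :
  tnth (adjoin (m := n.+1) x t) ord_max = t.
Proof. by rewrite tnth_mktuple/= nth_default// size_tuple. Qed.

Definition vinit n (x : Rvec R n.+1) : Rvec R n :=
  [tuple tnth x (widen_ord (leqnSn n) i) | i < n].

Definition vlast n (x : Rvec R n.+1) : RR := tnth x ord_max.

Lemma vinit_adjoin n (x : Rvec R n) (t : RR) :
  vinit (adjoin (m := n.+1) x t) = x.
Proof.
by apply: eq_from_tnth => i; rewrite tnth_mktuple tnth_adjoin_lift.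
Qed.

Lemma vlast_adjoin n (x : Rvec R n) (t : RR) :
  vlast (adjoin (m := n.+1) x t) = t.
Proof. exact: tnth_adjoin_max. Qed.

Lemma adjoin_vinit_vlast n (x : Rvec R n.+1) :
  adjoin (m := n.+1) (vinit x) (vlast x) = x.
Proof.
apply: eq_from_tnth => i; have [ltin|] := ltnP i n.
  have -> : i = widen_ord (leqnSn n) (Ordinal ltin) by exact: val_inj.
  by rewrite tnth_adjoin_lift tnth_mktuple.
move=> lein; have -> : i = ord_max.
  by apply: val_inj => /=; apply/eqP; rewrite eqn_leq lein -ltnS ltn_ord.
by rewrite tnth_adjoin_max.
Qed.

Lemma dot_adjoin n (x y : Rvec R n) (s t : RR) :
  dot (adjoin (m := n.+1) x s) (adjoin (m := n.+1) y t) = dot x y + s * t.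
Proof.
rewrite /dot big_ord_recr/= !tnth_adjoin_max; congr (_ + _).
by apply: eq_bigr => i _; rewrite !tnth_adjoin_lift.
Qed.

Lemma dotC n (x y : Rvec R n) : dot x y = dot y x.
Proof. by apply: eq_bigr => i _; rewrite mulrC. Qed.

Lemma dot_ge0 n (x : Rvec R n) : 0 <= dot x x.
Proof. by apply: sumr_ge0 => i _; rewrite -expr2 sqr_ge0. Qed.

Lemma enorm_sqr n (x : Rvec R n) : enorm x ^+ 2 = dot x x.
Proof. by rewrite /enorm sqr_sqrtr// dot_ge0. Qed.

Definition vscale n (c : R) (x : Rvec R n) : Rvec R n :=
  [tuple c * tnth x i | i < n].

Lemma vscale_adjoin n c (x : Rvec R n) (t : RR) :
  vscale c (adjoin (m := n.+1) x t) = adjoin (m := n.+1) (vscale c x) (c * t).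
Proof.
rewrite -[RHS]adjoin_vinit_vlast -[LHS]adjoin_vinit_vlast.
rewrite vinit_adjoin vlast_adjoin /vlast tnth_mktuple tnth_adjoin_max.
congr adjoin; apply: eq_from_tnth => i.
by rewrite [LHS]tnth_mktuple [LHS]tnth_mktuple tnth_adjoin_lift tnth_mktuple.
Qed.

Lemma dot_vscalel n c (x y : Rvec R n) : dot (vscale c x) y = c * dot x y.
Proof.
by rewrite /dot mulr_sumr; apply: eq_bigr => i _; rewrite tnth_mktuple mulrA.
Qed.

Lemma dot_vscaler n c (x y : Rvec R n) : dot x (vscale c y) = c * dot x y.
Proof. by rewrite dotC dot_vscalel dotC. Qed.

Lemma measurable_dot d (T : measurableType d) n (f g : T -> Rvec R n) :
  measurable_fun setT f -> measurable_fun setT g ->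
  measurable_fun setT (fun x => dot (f x) (g x) : RR).
Proof.
move=> mf mg; apply: measurable_sum => i; apply: measurable_funM.
  exact: (measurableT_comp (measurable_tnth i) mf).
exact: (measurableT_comp (measurable_tnth i) mg).
Qed.

Lemma measurable_vscale d (T : measurableType d) n (c : T -> RR)
    (f : T -> Rvec R n) : measurable_fun setT c -> measurable_fun setT f ->
  measurable_fun setT (fun x => vscale (c x) (f x)).
Proof.
move=> mc mf; apply/measurable_fun_tnthP => i.
rewrite (_ : _ \o _ = fun x => c x * tnth (f x) i); last first.
  by apply/funext => x /=; rewrite tnth_mktuple.
apply: measurable_funM => //; exact: (measurableT_comp (measurable_tnth i) mf).
Qed.

Lemma measurable_adjoin2 d (T : measurableType d) n (f : T -> Rvec R n)
    (c : T -> RR) : measurable_fun setT f -> measurable_fun setT c ->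
  measurable_fun setT (fun x => adjoin (m := n.+1) (f x) (c x)).
Proof.
move=> mf mc; have mp : measurable_fun setT (fun x => (f x, c x)).
  exact: measurable_fun_pair.
exact: (measurableT_comp (@measurable_adjoin R n.+1) mp).
Qed.

Lemma measurable_vinit n : measurable_fun setT (@vinit n).
Proof.
apply/measurable_fun_tnthP => i.
rewrite (_ : _ \o _ = fun x => tnth x (widen_ord (leqnSn n) i)).
  exact: measurable_tnth.
by apply/funext => x /=; rewrite tnth_mktuple.
Qed.

Lemma measurable_vlast n : measurable_fun setT (@vlast n).
Proof. exact: measurable_tnth. Qed.

Lemma ge0_integral_vec0 (g : Rvec R 0 -> \bar R) :
  measurable_fun setT g -> (\int[lebesgue_vec R 0]_x g x = g [tuple])%E.
Proof. by move=> mg; rewrite integral_dirac// diracT mul1e. Qed.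

Lemma ge0_integral_vecS_prod n (g : Rvec R n.+1 -> \bar R) :
  measurable_fun setT g -> (forall x, 0 <= g x)%E ->
  (\int[lebesgue_vec R n.+1]_x g x =
   \int[lebesgue_vec R n \x lam]_z g (adjoin (m := n.+1) z.1 z.2))%E.
Proof.
move=> mg g0; have mad := @measurable_adjoin R n.+1.
exact: (@ge0_integral_pushforward _ _ _ _ R _ mad (lebesgue_vec R n \x lam)%E setT g).
Qed.

Lemma ge0_integral_vecS n (g : Rvec R n.+1 -> \bar R) :
  measurable_fun setT g -> (forall x, 0 <= g x)%E ->
  (\int[lebesgue_vec R n.+1]_x g x =
   \int[lebesgue_vec R n]_x \int[lam]_t g (adjoin (m := n.+1) x t))%E.
Proof.
move=> mg g0; rewrite ge0_integral_vecS_prod// fubini_tonelli1//.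
exact: (measurableT_comp mg (@measurable_adjoin R n.+1)).
Qed.

(** One linear substitution per coordinate, each contributing a factor [|c|]. *)
Lemma ge0_integral_vscale n (c : R) (g : Rvec R n -> \bar R) : c != 0 ->
  measurable_fun setT g -> (forall x, 0 <= g x)%E ->
  (\int[lebesgue_vec R n]_x (g (vscale c x) * (`|c| ^+ n)%:E) =
   \int[lebesgue_vec R n]_x g x)%E.
Proof.
move=> c0; elim: n g => [|n IHn] g mg g0.
  have msc := measurable_vscale (measurable_cst (c : RR))
                (@measurable_id _ (Rvec R 0) setT).
  rewrite !ge0_integral_vec0//.
    by rewrite expr0 mule1; congr g; apply: eq_from_tnth => -[].
  by apply: emeasurable_funM => //; exact: (measurableT_comp mg msc).
have msc := measurable_vscale (measurable_cst (c : RR))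
              (@measurable_id _ (Rvec R n.+1) setT).
rewrite !ge0_integral_vecS//; last 2 first.
- by apply: emeasurable_funM => //; exact: (measurableT_comp mg msc).
- by move=> x; rewrite mule_ge0// lee_fin exprn_ge0.
pose G x := (\int[lam]_t g (adjoin (m := n.+1) x t))%E.
have mgad : measurable_fun setT
    (fun z : Rvec R n * RR => g (adjoin (m := n.+1) z.1 z.2)).
  exact: (measurableT_comp mg (@measurable_adjoin R n.+1)).
have mG : measurable_fun setT G.
  exact: (measurable_fun_fubini_tonelli_F _ mgad).
rewrite -(IHn G)//; last by move=> x; exact: integral_ge0.
apply: eq_integral => x _.
have mgx : measurable_fun setT (fun t : RR => g (adjoin (m := n.+1) (vscale c x) t)).
  by apply: (measurableT_comp mg); apply: measurable_adjoin2.
rewrite /G -(@ge0_integral_affine _ c 0 _ c0 mgx)// -ge0_integralZr//.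
- apply: eq_integral => t _.
  by rewrite vscale_adjoin addr0 -muleA -EFinM -exprS.
- have maff : measurable_fun setT (fun t : RR => (c * t + 0)%R : RR).
    by apply: measurable_funD; [exact: measurable_funM|exact: measurable_cst].
  by apply: emeasurable_funM; [exact: (measurableT_comp mgx maff)|].
- by move=> t _; rewrite mule_ge0.
Qed.

End vectors.

(** * Gaussian integrals *)

Section gaussian.
Variable R : realType.
Local Notation RR := (measurableTypeR R).
Local Notation lam := (@lebesgue_measure R).
Local Notation gau := (@gauss_fun R).
Implicit Type g : RR -> \bar R.

Lemma measurable_affine (c d : R) :
  measurable_fun setT (fun t : RR => c * t + d : RR).
Proof.
by apply: measurable_funD; [exact: measurable_funM|exact: measurable_cst].
Qed.

Lemma measurable_scale (c : R) :
  measurable_fun setT (fun t : RR => c * t : RR).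
Proof. exact: measurable_funM. Qed.

Lemma measurable_gauss d (T : measurableType d) (f : T -> RR) :
  measurable_fun setT f -> measurable_fun setT (fun x => gau (f x)).
Proof. exact: (measurableT_comp (@measurable_gauss_fun R)). Qed.

Lemma measurable_gaussE D : measurable_fun D (fun r : RR => (gau r)%:E).
Proof.
apply/measurable_funTS/measurable_EFinP.
exact: (measurable_gauss (@measurable_id _ RR setT)).
Qed.

Lemma integral_gauss_affine (c d : R) : c != 0 ->
  (\int[lam]_t (gau (c * t + d)%R)%:E = (Num.sqrt pi / `|c|)%:E)%E.
Proof.
move=> c0; have mg : measurable_fun setT (fun t : RR => (gau t)%:E).
  exact: measurable_gaussE.
have g0 (r : R) : (0 <= (gau r)%:E)%E by rewrite lee_fin gauss_fun_ge0.
have ma : measurable_fun setT (fun t : RR => (gau (c * t + d))%:E).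
  apply/measurable_EFinP/measurable_gauss; exact: measurable_affine.
rewrite EFinM -integralT_gauss -(ge0_integral_affine d c0 mg)//.
rewrite ge0_integralZr// ?lee_fin// -muleA -EFinM.
by rewrite mulfV ?normr_eq0// mule1.
Qed.

(** The Gaussian is even. This allows the later statements to constrain a scale through its square
    only. *)
Lemma ge0_integral_gauss_sign g (s t : R) : s ^+ 2 = t ^+ 2 ->
  measurable_fun setT g -> (forall r, 0 <= g r)%E ->
  (\int[lam]_w (g (s * w)%R * (gau w)%:E) =
   \int[lam]_w (g (t * w)%R * (gau w)%:E))%E.
Proof.
move=> /eqP; rewrite eqf_sqr => /orP[/eqP -> //|/eqP ->] mg g0.
have mh : measurable_fun setT (fun w : RR => g (t * w)%R * (gau w)%:E)%E.
  apply: emeasurable_funM; last exact: measurable_gaussE.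
  exact: (measurableT_comp mg (measurable_scale _)).
rewrite -[RHS](@ge0_integral_affine _ (-1) 0)//.
- apply: eq_integral => w _; rewrite normrN1 mule1 addr0 mulN1r mulNr mulrN.
  by rewrite /gauss_fun sqrrN.
- by move=> r; rewrite mule_ge0// lee_fin gauss_fun_ge0.
Qed.

(* Complete the square: with u = p s + q r, the exponent s^2 + r^2 equals
   (u / sigma)^2 + ((sigma / q) s - (p / (sigma q)) u)^2. *)
Lemma ge0_integral_gauss2 g (p q sigma : R) : sigma ^+ 2 = p ^+ 2 + q ^+ 2 ->
  measurable_fun setT g -> (forall r, 0 <= g r)%E ->
  (\int[lam]_s \int[lam]_r (g (p * s + q * r)%R * (gau s * gau r)%:E) =
   (Num.sqrt pi)%:E * \int[lam]_w (g (sigma * w)%R * (gau w)%:E))%E.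
Proof.
move=> spq mg g0.
have gau0 (r : R) : (0 <= (gau r)%:E)%E by rewrite lee_fin gauss_fun_ge0.
have mgau D : measurable_fun D (fun r : RR => (gau r)%:E).
  exact: measurable_gaussE.
have sp0 : (0 <= (Num.sqrt (@pi R))%:E)%E by rewrite lee_fin sqrtr_ge0.
have mgs (c : R) : measurable_fun setT (fun w : RR => g (c * w)%R * (gau w)%:E)%E.
  apply: emeasurable_funM; last exact: mgau.
  exact: (measurableT_comp mg (measurable_scale _)).
have gs0 (c w : R) : (0 <= g (c * w)%R * (gau w)%:E)%E by rewrite mule_ge0.
(* For [q = 0] the variable [r] separates and contributes the factor [sqrt pi]; [sigma] is then [p]
   up to sign. *)
have [q0|q0] := eqVneq q 0.
  have := @ge0_integral_gauss_sign g sigma p _ mg g0.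
  rewrite spq q0 expr0n addr0 => ->//.
  rewrite -ge0_integralZl//.
  apply: eq_integral => s _.
  under eq_integral do rewrite mul0r addr0 EFinM muleA.
  rewrite ge0_integralZl//.
  by rewrite integralT_gauss muleC.
have s0 : sigma != 0.
  rewrite -sqrf_eq0 spq; have := sqr_ge0 p; have : 0 < q ^+ 2.
    by rewrite exprn_even_gt0.
  by move=> ? ?; rewrite gt_eqF// ltr_wpDl.
(* The integrand after replacing [r] by [w = p * s + q * r] at fixed [s]. *)
pose K (s w : R) := (g w * (gau s * gau ((w - p * s) / q) / `|q|)%:E)%E.
have K0 s w : (0 <= K s w)%E.
  by rewrite mule_ge0// lee_fin mulr_ge0// mulr_ge0// gauss_fun_ge0.
have mK : measurable_fun setT (fun z : RR * RR => K z.1 z.2).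
  apply: emeasurable_funM.
    exact: (measurableT_comp mg measurable_snd).
  apply/measurable_EFinP; apply: measurable_funM; last exact: measurable_cst.
  apply: measurable_funM; first exact: measurable_gauss.
  apply: measurable_gauss; apply: measurable_funM; last exact: measurable_cst.
  by apply: measurable_funB => //; exact: measurable_funM.
have mKs s : measurable_fun setT (K s).
  exact: (measurableT_comp mK (measurable_pair1 s)).
transitivity (\int[lam]_s \int[lam]_w K s w)%E.
  apply: eq_integral => s _.
  rewrite -(@ge0_integral_affine _ q (p * s) _ q0 (mKs s))//.
  apply: eq_integral => r _; rewrite /K -muleA -EFinM [(p * s + q * r)%R]addrC.
  congr (_ * _%:E)%E.
  have -> : (q * r + p * s - p * s) / q = r by field.
  by rewrite mulfVK// normr_eq0.
rewrite (fubini_tonelli (fun z : RR * RR => K z.1 z.2))//=.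
rewrite -ge0_integralZl//.
(* What remains of [K] after integrating out [s], by the completed square. *)
pose H (w : R) := ((Num.sqrt pi)%:E * (g w * (gau (w / sigma) / `|sigma|)%:E))%E.
have mH : measurable_fun setT H.
  apply: emeasurable_funM; first exact: measurable_cst.
  apply: emeasurable_funM => //; apply/measurable_EFinP.
  apply: measurable_funM; last exact: measurable_cst.
  by apply: measurable_gauss; exact: measurable_funM.
transitivity (\int[lam]_w H w)%E; last first.
  rewrite -(@ge0_integral_affine _ sigma 0 _ s0 mH)//.
  - apply: eq_integral => w _; rewrite /H addr0 -!muleA -EFinM.
    by rewrite mulfVK ?normr_eq0// mulrAC mulfV// mul1r.
  - move=> w; rewrite /H mule_ge0 ?lee_fin ?sqrtr_ge0// mule_ge0//.
    by rewrite lee_fin mulr_ge0// gauss_fun_ge0.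
apply: eq_integral => w _.
have gE s : (gau s * gau ((w - p * s) / q) / `|q|) =
    (gau (w / sigma) / `|q|) * gau (sigma / q * s + - (p / (sigma * q) * w)).
  rewrite [RHS]mulrAC; congr (_ / _); rewrite /gauss_fun -!expRD.
  congr (expR _); rewrite -!opprD; congr (- _).
  have -> : s ^+ 2 + ((w - p * s) / q) ^+ 2 =
     (w ^+ 2 * q ^+ 0 - 2 * w * p * s + s ^+ 2 * (p ^+ 2 + q ^+ 2)) / q ^+ 2 by field.
  rewrite -spq expr0 mulr1.
  have qE : q ^+ 2 = sigma ^+ 2 - p ^+ 2 by rewrite spq addrAC subrr add0r.
  rewrite [in RHS]sqrrD [in RHS]sqrrN.
  have -> : (w / sigma) ^+ 2 = w ^+ 2 * q ^+ 2 / (sigma ^+ 2 * q ^+ 2).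
    by field; rewrite s0 q0.
  rewrite [in w ^+ 2 * q ^+ 2]qE; field.
  by rewrite s0 q0.
under eq_integral do rewrite /K gE EFinM muleA.
have mgq : measurable_fun setT (fun s : RR =>
    (gau (sigma / q * s + - (p / (sigma * q) * w))%R)%:E).
  apply/measurable_EFinP/measurable_gauss; exact: measurable_affine.
have gq0 : (0 <= g w * (gau (w / sigma) / `|q|)%:E)%E.
  by rewrite mule_ge0// lee_fin mulr_ge0// gauss_fun_ge0.
rewrite ge0_integralZl//.
rewrite integral_gauss_affine; last by rewrite mulf_neq0// invr_eq0.
rewrite /H -muleA -EFinM muleCA -EFinM; congr (_ * _%:E)%E.
rewrite normrM normfV; field.
by rewrite !normr_eq0 s0 q0.
Qed.

Lemma measurable_gauss_vec n g (x : Rvec R n) (t : R) : measurable_fun setT g ->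
  measurable_fun setT (fun z : Rvec R n * RR =>
    g (dot z.1 x + t * z.2)%R * (expR (- dot z.1 z.1) * gau z.2)%:E)%E.
Proof.
move=> mg.
have md1 := measurable_dot (@measurable_fst _ _ (Rvec R n) RR)
  (@measurable_cst _ _ _ (Rvec R n) setT x).
have md2 := measurable_dot (@measurable_fst _ _ (Rvec R n) RR)
  (@measurable_fst _ _ (Rvec R n) RR).
apply: emeasurable_funM.
  apply: (measurableT_comp mg); apply: measurable_funD; first exact: md1.
  exact: (measurableT_comp (measurable_scale t) measurable_snd).
apply/measurable_EFinP; apply: measurable_funM.
  have mN : measurable_fun setT (fun z : Rvec R n * RR => - dot z.1 z.1).
    exact: (measurableT_comp (@oppr_measurable R setT) md2).
  exact: (measurableT_comp (@measurable_expR R) mN).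
exact: measurable_gauss.
Qed.

(** Rotation invariance one plane at a time: [ge0_integral_gauss2] merges the last coordinate of [y]
    with [r], which replaces the coefficient [t] by [s'], the length of the last coordinate of [x]
    together with [t], and releases a factor [sqrt pi]. *)
Lemma ge0_integral_gauss_vec n g (x : Rvec R n) (t sigma : R) :
  sigma ^+ 2 = dot x x + t ^+ 2 ->
  measurable_fun setT g -> (forall r, 0 <= g r)%E ->
  (\int[lebesgue_vec R n]_y \int[lam]_r
     (g (dot y x + t * r)%R * (expR (- dot y y) * gau r)%:E) =
   (Num.sqrt pi ^+ n)%:E * \int[lam]_w (g (sigma * w)%R * (gau w)%:E))%E.
Proof.
elim: n g x t sigma => [|n IHn] g x t sigma sE mg g0.
  have mF := measurable_gauss_vec x t mg.
  have F0 (z : Rvec R 0 * RR) :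
      (0 <= g (dot z.1 x + t * z.2)%R * (expR (- dot z.1 z.1) * gau z.2)%:E)%E.
    by rewrite mule_ge0// lee_fin mulr_ge0 ?expR_ge0.
  rewrite ge0_integral_vec0; last exact: (measurable_fun_fubini_tonelli_F _ mF).
  rewrite expr0 mul1e (@ge0_integral_gauss_sign g sigma t)//; last first.
    by rewrite sE /dot big_ord0 add0r.
  apply: eq_integral => r _.
  by rewrite /dot !big_ord0 add0r oppr0 expR0 mul1r.
have mF := measurable_gauss_vec x t mg.
have F0 (z : Rvec R n.+1 * RR) :
    (0 <= g (dot z.1 x + t * z.2)%R * (expR (- dot z.1 z.1) * gau z.2)%:E)%E.
  by rewrite mule_ge0// lee_fin mulr_ge0 ?expR_ge0.
rewrite ge0_integral_vecS; last 2 first.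
- exact: (measurable_fun_fubini_tonelli_F _ mF).
- by move=> y; apply: integral_ge0 => r _; exact: (F0 (y, r)).
pose x' := vinit x; pose u := vlast x; pose s' := Num.sqrt (u ^+ 2 + t ^+ 2).
have s'E : s' ^+ 2 = u ^+ 2 + t ^+ 2 by rewrite sqr_sqrtr// addr_ge0 ?sqr_ge0.
have sE' : sigma ^+ 2 = dot x' x' + s' ^+ 2.
  by rewrite s'E sE -[x in LHS]adjoin_vinit_vlast dot_adjoin -expr2 addrA.
have mF' := measurable_gauss_vec x' s' mg.
have F'0 (z : Rvec R n * RR) :
    (0 <= g (dot z.1 x' + s' * z.2)%R * (expR (- dot z.1 z.1) * gau z.2)%:E)%E.
  by rewrite mule_ge0// lee_fin mulr_ge0 ?expR_ge0.
have pi0 : (0 <= (Num.sqrt (@pi R))%:E)%E by rewrite lee_fin sqrtr_ge0.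
rewrite exprS EFinM -muleA -(IHn g x' s' sigma sE' mg g0) -ge0_integralZl//; last 2 first.
- exact: (measurable_fun_fubini_tonelli_F _ mF').
- by move=> y _; apply: integral_ge0 => r _; exact: (F'0 (y, r)).
apply: eq_integral => y _.
(* The remaining coordinates [y] are frozen and absorbed into the function, which is why [g] is
   arbitrary in the induction. *)
pose gy v := (g (dot y x' + v)%R * (expR (- dot y y))%:E)%E.
have mgy : measurable_fun setT gy.
  apply: emeasurable_funM; last exact: measurable_cst.
  by apply: (measurableT_comp mg); apply: measurable_funD.
have gy0 v : (0 <= gy v)%E by rewrite mule_ge0// lee_fin expR_ge0.
transitivity (\int[lam]_s \int[lam]_r
    (gy (u * s + t * r)%R * (gau s * gau r)%:E))%E.
  apply: eq_integral => s _; apply: eq_integral => r _.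
  rewrite /gy -muleA -EFinM -[x in dot _ x]adjoin_vinit_vlast !dot_adjoin.
  rewrite -[vlast x]/u -[vinit x]/x' addrA (mulrC u) opprD expRD.
  by rewrite /gauss_fun expr2 !mulrA.
rewrite (ge0_integral_gauss2 s'E mgy gy0); congr (_ * _)%E.
by apply: eq_integral => w _; rewrite /gy -muleA -EFinM.
Qed.

End gaussian.

(** * The law of the kernel *)

Section kernel_law.
Variables (R : realType) (n : nat) (eps : R).
Hypothesis eps0 : 0 <= eps.
Local Notation RR := (measurableTypeR R).
Local Notation lam := (@lebesgue_measure R).
Local Notation gau := (@gauss_fun R).
Implicit Types (g : RR -> \bar R) (a y : Rvec R n) (b t r : R).

Definition hyperplane_weight (a : Rvec R n) (b : R) : R :=
  Num.sqrt (1 + dot a a + eps * b ^+ 2).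

(** The rescaling that absorbs a second Gaussian factor: [exp (- w ^ 2 - eps * N * w ^ 2)] is
    [gau (w / point_weight N)]. Here [N] stands for the squared norm of a point. *)
Definition point_weight (N : R) : R := (Num.sqrt (1 + eps * N))^-1.

Let q_ge0 a b : 0 <= dot a a + eps * b ^+ 2.
Proof.
by apply: addr_ge0; [exact: dot_ge0|apply: mulr_ge0 => //; exact: sqr_ge0].
Qed.

Lemma hyperplane_weight_sqr a b :
  hyperplane_weight a b ^+ 2 = 1 + dot a a + eps * b ^+ 2.
Proof. by rewrite sqr_sqrtr// -addrA addr_ge0. Qed.

Lemma hyperplane_weight_gt0 a b : 0 < hyperplane_weight a b.
Proof.
by rewrite /hyperplane_weight sqrtr_gt0 -addrA ltr_pwDl.
Qed.

Lemma point_weight_gt0 (N : R) : 0 <= N -> 0 < point_weight N.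
Proof. by move=> N0; rewrite invr_gt0 sqrtr_gt0 ltr_pwDl// mulr_ge0. Qed.

Lemma measurable_hyperplane_weight d (T : measurableType d)
    (f : T -> Rvec R n) (h : T -> RR) :
  measurable_fun setT f -> measurable_fun setT h ->
  measurable_fun setT (fun z => hyperplane_weight (f z) (h z) : RR).
Proof.
move=> mf mh.
apply: (measurableT_comp (continuous_measurable_fun (@sqrt_continuous R))).
apply: measurable_funD.
  by apply: measurable_funD; [exact: measurable_cst|exact: measurable_dot].
apply: measurable_funM; first exact: measurable_cst.
exact: measurable_funX.
Qed.

Variables (x : Rvec R n) (t0 : R).
Let v a := t0 - dot a x.
Let sg a := hyperplane_weight a (v a).
Let N := dot x x + t0 ^+ 2.

Let N0 : 0 <= N.
Proof. by rewrite addr_ge0 ?dot_ge0 ?sqr_ge0. Qed.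

Lemma measurable_offset : measurable_fun setT (v : Rvec R n -> RR).
Proof.
apply: measurable_funB; first exact: measurable_cst.
by apply: measurable_dot; [exact: measurable_id|exact: measurable_cst].
Qed.

Let msg : measurable_fun setT (sg : Rvec R n -> RR).
Proof. exact: measurable_hyperplane_weight (@measurable_id _ _ _) measurable_offset. Qed.

(** [A] is the left integrand of [kernel_law] once [r] has been scaled by [sg a], and [H] is what
    [A] becomes under [y = - r a], up to the Jacobian. In [H] the factor containing [eps] depends on
    [dot y x + t0 * r] alone, so it can be merged with [g] into [geps g]. *)
Let A g a r := (g (r * v a)%R * (`|r| ^+ n * gau (sg a * r))%:E)%E.

Let H g y r := (g (dot y x + t0 * r)%R * (expR (- (eps * (dot y x + t0 * r) ^+ 2)))%:E
  * (expR (- dot y y) * gau r)%:E)%E.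

Let geps g u := (g u * (expR (- (eps * u ^+ 2)))%:E)%E.

Let mgeps g : measurable_fun setT g -> measurable_fun setT (geps g).
Proof.
move=> mg; apply: emeasurable_funM => //; apply/measurable_EFinP.
have mN : measurable_fun setT (fun u : RR => - (eps * u ^+ 2)).
  apply: (measurableT_comp (@oppr_measurable R setT)).
  apply: measurable_funM; first exact: measurable_cst.
  exact: measurable_funX.
exact: (measurableT_comp (@measurable_expR R) mN).
Qed.

Let geps0 g u : (forall u, 0 <= g u)%E -> (0 <= geps g u)%E.
Proof. by move=> g0; rewrite mule_ge0// lee_fin expR_ge0. Qed.

Let mA g : measurable_fun setT g ->
  measurable_fun setT (fun z : Rvec R n * RR => A g z.1 z.2).
Proof.
move=> mg; have mv : measurable_fun setT (fun z : Rvec R n * RR => v z.1 : RR).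
  exact: (measurableT_comp measurable_offset measurable_fst).
have ms : measurable_fun setT (fun z : Rvec R n * RR => sg z.1 : RR).
  exact: (measurableT_comp msg measurable_fst).
apply: emeasurable_funM.
  by apply: (measurableT_comp mg); exact: measurable_funM.
apply/measurable_EFinP; apply: measurable_funM.
  apply: measurable_funX; exact: (measurableT_comp (@normr_measurable R setT) measurable_snd).
by apply: measurable_gauss; exact: measurable_funM.
Qed.

Let A0 g a r : (forall u, 0 <= g u)%E -> (0 <= A g a r)%E.
Proof.
by move=> g0; rewrite mule_ge0// lee_fin mulr_ge0 ?exprn_ge0 ?gauss_fun_ge0.
Qed.

Let H0 g y r : (forall u, 0 <= g u)%E -> (0 <= H g y r)%E.
Proof.
move=> g0; rewrite mule_ge0//; first exact: (geps0 _ g0).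
by rewrite lee_fin mulr_ge0 ?expR_ge0.
Qed.

(** With [y = - r a] the exponent [(sg a * r) ^ 2] splits into [r ^ 2], the squared norm of [y] and
    [eps * (r * v a) ^ 2]; the factor [|r| ^+ n] is the Jacobian. *)
Let HA g r : r != 0 -> measurable_fun setT g -> (forall u, 0 <= g u)%E ->
  (\int[lebesgue_vec R n]_a A g a r = \int[lebesgue_vec R n]_y H g y r)%E.
Proof.
move=> r0 mg g0.
have mH : measurable_fun setT (fun y => H g y r).
  exact: (measurableT_comp (measurable_gauss_vec x t0 (mgeps mg)) (measurable_pair2 r)).
rewrite -(@ge0_integral_vscale _ _ (- r) _ _ mH) ?oppr_eq0//; last first.
  by move=> y; exact: H0.
apply: eq_integral => a _; rewrite /A /H !dot_vscalel dot_vscaler normrN.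
have -> : - r * dot a x + t0 * r = r * v a by rewrite /v; ring.
rewrite -!muleA -!EFinM; congr (_ * _%:E)%E.
rewrite mulrC mulrA; congr (_ * _); rewrite /gauss_fun -!expRD.
congr expR; rewrite exprMn hyperplane_weight_sqr; ring.
Qed.

(* For fixed [r] the substitution [y = - r a] turns [r * v a] into
   [dot y x + t0 * r] and the weight into [expR (- (|y|^2 + r^2))] times
   [expR (- eps (dot y x + t0 * r)^2)]; by rotation invariance only the
   component of [(y, r)] along [(x, t0)] matters. *)
Lemma kernel_law g : measurable_fun setT g -> (forall u, 0 <= g u)%E ->
  (\int[lebesgue_vec R n]_a \int[lam]_r
     (g (r * (v a / sg a))%R * (`|r| ^+ n * gau r * (sg a) ^- n.+1)%:E) =
   \int[lam]_w (g (Num.sqrt N * point_weight N * w)%R *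
     (Num.sqrt pi ^+ n * point_weight N * gau w)%:E))%E.
Proof.
move=> mg g0.
transitivity (\int[lebesgue_vec R n]_a \int[lam]_r A g a r)%E.
  apply: eq_integral => a _.
  have s0 : 0 < sg a := hyperplane_weight_gt0 a (v a).
  have sn0 : sg a != 0 by rewrite gt_eqF.
  pose K r := (g (r * (v a / sg a))%R * (`|r| ^+ n * gau r * (sg a) ^- n.+1)%:E)%E.
  have mK : measurable_fun setT (K : RR -> _).
    apply: emeasurable_funM.
      by apply: (measurableT_comp mg); exact: measurable_funM.
    apply/measurable_EFinP; apply: measurable_funM; last exact: measurable_cst.
    apply: measurable_funM; last exact: measurable_gauss.
    by apply: measurable_funX; exact: normr_measurable.
  (* Scaling [r] by [sg a] moves the hyperplane weight from the argument of [g] into the Gaussian: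
     [n] factors come from [|r| ^+ n] and one from the Jacobian, which uses up [sg a ^- n.+1]. *)
  rewrite -[LHS](@ge0_integral_affine _ (sg a) 0 K sn0 mK); last first.
    move=> r; rewrite mule_ge0// lee_fin !mulr_ge0 ?exprn_ge0 ?gauss_fun_ge0//.
    by rewrite invr_ge0 exprn_ge0// ltW.
  apply: eq_integral => r _; rewrite /K /A addr0 -muleA -EFinM.
  have -> : sg a * r * (v a / sg a) = r * v a by field.
  congr (_ * _%:E)%E; rewrite normrM (gtr0_norm s0) exprMn exprS.
  by field; rewrite expf_neq0// sn0.
rewrite (fubini_tonelli (fun z : Rvec R n * RR => A g z.1 z.2))//=; last 2 first.
- exact: mA.
- by move=> z; exact: A0.
transitivity (\int[lam]_r \int[lebesgue_vec R n]_y H g y r)%E.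
  (* The substitution [y = - r a] degenerates only at [r = 0]. *)
  apply: (@integral_eq_off_null _ _ _ (@lebesgue_measure R) _ _ _
    (measurable_set1 (0 : R)) (lebesgue_measure_set1 0)).
  by move=> r /eqP r0; exact: HA.
rewrite -(fubini_tonelli (fun z : Rvec R n * RR => H g z.1 z.2))//=; last 2 first.
- exact: (measurable_gauss_vec x t0 (mgeps mg)).
- by move=> z; exact: H0.
rewrite (@ge0_integral_gauss_vec _ _ (geps g) x t0 (Num.sqrt N)); last 3 first.
- by rewrite sqr_sqrtr.
- exact: mgeps.
- by move=> u; exact: geps0.
have k0 : 0 < point_weight N := point_weight_gt0 N0.
have kn0 : point_weight N != 0 by rewrite gt_eqF.
pose K w := (g (Num.sqrt N * w)%R * (gau (w / point_weight N))%:E)%E.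
have mK : measurable_fun setT (K : RR -> _).
  apply: emeasurable_funM.
    exact: (measurableT_comp mg (measurable_scale _)).
  by apply/measurable_EFinP; apply: measurable_gauss; exact: measurable_funM.
have K0 w : (0 <= K w)%E by rewrite mule_ge0// lee_fin gauss_fun_ge0.
have -> : (\int[lam]_w (geps g (Num.sqrt N * w)%R * (gau w)%:E) = \int[lam]_w K w)%E.
  apply: eq_integral => w _; rewrite /K /geps -muleA -EFinM; congr (_ * _%:E)%E.
  rewrite /gauss_fun -expRD; congr expR.
  rewrite exprMn sqr_sqrtr// /point_weight invrK exprMn sqr_sqrtr; first by ring.
  by rewrite addr_ge0 ?mulr_ge0.
(* Scaling [w] by [point_weight N] restores the standard Gaussian, at the cost of the factor
   [point_weight N]. *)
rewrite -(@ge0_integral_affine _ (point_weight N) 0 K kn0 mK)// -ge0_integralZl//.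
- apply: eq_integral => w _; rewrite /K addr0 muleCA -!muleA -!EFinM !mulrA.
  congr (g _ * _%:E)%E.
  rewrite gtr0_norm//; have -> : point_weight N * w / point_weight N = w by field.
  by ring.
- apply: emeasurable_funM; last exact: measurable_cst.
  exact: (measurableT_comp mK (@measurable_affine _ _ _)).
- by move=> w _; rewrite mule_ge0.
Qed.

End kernel_law.

(** * The Gamma function *)

Section half_line.
Variable R : realType.
Local Notation RR := (measurableTypeR R).
Local Notation lam := (@lebesgue_measure R).
Local Notation pos := (`]0, +oo[%classic : set RR).

(** Compact intervals that exhaust the half-line and avoid 0, where [F] may be singular. *)
Let I (k : nat) : set RR := `[k.+1%:R^-1, k.+1%:R]%classic.

Let bigcupI : \bigcup_k I k = pos.
Proof.
apply/seteqP; split => t /=.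
  move=> [k _]; rewrite /I /= !in_itv/= andbT => /andP[kt _].
  by rewrite (lt_le_trans _ kt)// invr_gt0.
rewrite in_itv/= andbT => t0.
have [k Hk] : exists k : nat, t <= k.+1%:R /\ t^-1 <= k.+1%:R.
  exists (maxn (Num.truncn t) (Num.truncn t^-1)); split.
    apply: le_trans (ltW (truncnS_gt t)) _.
    by rewrite ler_nat ltnS leq_maxl.
  apply: le_trans (ltW (truncnS_gt t^-1)) _.
  by rewrite ler_nat ltnS leq_maxr.
exists k => //; rewrite /I/= in_itv/= Hk.1 andbT.
by rewrite -[t]invrK lef_pV2 ?posrE ?invr_gt0//; exact: Hk.2.
Qed.

Let ndI : nondecreasing_seq I.
Proof.
move=> m n mn; apply/subsetPset => t; rewrite /I/= !in_itv/= => /andP[mt tm].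
apply/andP; split; last by rewrite (le_trans tm)// ler_nat ltnS.
by rewrite (le_trans _ mt)// lef_pV2 ?posrE// ler_nat ltnS.
Qed.

Let mI k : measurable (I k).
Proof. exact: measurable_itv. Qed.

Let leI k : (k.+1%:R^-1 : R) <= k.+1%:R.
Proof. by rewrite (@le_trans _ _ 1)// ?invf_le1// ler1n. Qed.

Let Ipos k t : I k t -> 0 < t.
Proof.
by rewrite /I/= in_itv/= => /andP[kt _]; rewrite (lt_le_trans _ kt)// invr_gt0.
Qed.

Variables (f F : R -> R).
Hypothesis dF : forall t : R, 0 < t -> is_derive t 1 F (f t).
Hypothesis cf : forall t : R, 0 < t -> {for t, continuous f}.

Lemma measurable_fun_pos_continuous : measurable_fun pos (f : RR -> R).
Proof.
apply: open_continuous_measurable_fun; first exact: interval_open.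
by move=> t; rewrite inE/= in_itv/= andbT; exact: cf.
Qed.
Let mf := measurable_fun_pos_continuous.

Let mfI k : measurable_fun (I k) (fun t : RR => (f t)%:E).
Proof.
apply/measurable_EFinP; apply: measurable_funS mf; first exact: measurable_itv.
by rewrite -bigcupI; exact: bigcup_sup.
Qed.

Let intI k : (\int[lam]_(t in I k) (f t)%:E = (F k.+1%:R - F k.+1%:R^-1)%:E)%E.
Proof.
apply: integral_is_derive => // t /andP[kt _]; [apply: dF|apply: cf];
by rewrite (lt_le_trans _ kt)// invr_gt0.
Qed.

(** On each compact interval the integral is a difference of two values of [F]; monotone convergence
    keeps the bound. *)
Lemma ge0_integral_pos_bounded (M : R) : (forall t, 0 < t -> 0 <= f t) ->
  (forall t, 0 < t -> `|F t| <= M) ->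
  (\int[lam]_(t in pos) (f t)%:E <= (2 * M)%:E)%E.
Proof.
move=> f0 FM; rewrite -bigcupI.
have cv := ge0_nondecreasing_set_cvg_integral (mu := lam) ndI mI mfI
  (fun k t Ikt => f0 t (Ipos Ikt)).
rewrite -(cvg_lim _ cv)//; apply: lime_le; first by apply/cvg_ex; eexists; exact: cv.
apply: nearW => k; rewrite intI lee_fin; apply: le_trans (ler_norm _) _.
apply: le_trans (ler_normB _ _) _; rewrite mulr_natl mulr2n.
by apply: lerD; apply: FM => //; rewrite invr_gt0.
Qed.

(** Since [f] may change sign, monotone convergence is applied to its two parts; integrability makes
    both limits finite, so that they can be subtracted. *)
Lemma integral_pos_derive_eq0 : lam.-integrable pos (fun t => (f t)%:E) ->
  F k.+1%:R @[k --> \oo] --> (0 : R) ->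
  F k.+1%:R^-1 @[k --> \oo] --> (0 : R) ->
  (\int[lam]_(t in pos) (f t)%:E = 0)%E.
Proof.
move=> fi Fy F0.
have mfE : measurable_fun pos (fun t : RR => (f t)%:E) by exact: measurable_int fi.
have cvp := ge0_nondecreasing_set_cvg_integral (mu := lam) ndI mI
  (fun k => measurable_funepos (@mfI k)) (fun k t _ => funepos_ge0 _ t).
have cvn := ge0_nondecreasing_set_cvg_integral (mu := lam) ndI mI
  (fun k => measurable_funeneg (@mfI k)) (fun k t _ => funeneg_ge0 _ t).
rewrite bigcupI in cvp cvn.
have finp : (\int[lam]_(t in pos) (fun t : RR => (f t)%:E)^\+ t \is a fin_num)%E.
  by apply: integrable_fin_num => //; exact: integrable_funepos.
have finn : (\int[lam]_(t in pos) (fun t : RR => (f t)%:E)^\- t \is a fin_num)%E.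
  by apply: integrable_fin_num => //; exact: integrable_funeneg.
have finN : ((- (\int[lam]_(t in pos) (fun t : RR => (f t)%:E)^\- t)) \is a fin_num)%E.
  by rewrite fin_numN.
have /(_ eventually_filter) cv := cvgeB (fin_num_adde_defl _ finN) cvp cvn.
rewrite integralE -(cvg_lim (@ereal_hausdorff R) cv); apply/cvg_lim => //.
have -> : (fun k => \int[lam]_(t in I k) (fun t : RR => (f t)%:E)^\+ t -
    \int[lam]_(t in I k) (fun t : RR => (f t)%:E)^\- t)%E =
    EFin \o (fun k => F k.+1%:R - F k.+1%:R^-1).
  by apply/funext => k /=; rewrite -integralE intI.
apply: cvg_EFin; first exact: nearW.
by rewrite -[X in _ --> X](subr0 (0 : R)); exact: cvgB.
Qed.

End half_line.

(** * The Gamma integrand and its functional equation *)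

Section gamma_integrand.
Variable R : realType.
Local Notation RR := (measurableTypeR R).
Local Notation lam := (@lebesgue_measure R).
Local Notation pos := (`]0, +oo[%classic : set RR).
Implicit Types (s t x y phi : R).

Lemma powR_expR t a : 0 < t -> t `^ a = expR (a * ln t).
Proof. by move=> t0; rewrite /powR gt_eqF. Qed.

(** The concave function [p * ln t] lies below its tangent at [t = p]; equivalently,
    [t ^ p * exp (- t)] is largest at [p]. *)
Lemma ln_le_linear p t : 0 < p -> 0 < t -> p * ln t <= t + (p * ln p - p).
Proof.
move=> p0 t0; have tp : 0 < t / p by rewrite divr_gt0.
have : ln (1 + (t / p - 1)) <= t / p - 1 by apply: le_ln1Dx; lra.
rewrite addrC subrK ln_div ?posrE// => H.
have : p * (ln t - ln p) <= p * (t / p - 1) by rewrite ler_pM2l.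
by rewrite (mulrBr p (t / p)) mulrCA mulfV ?gt_eqF// !mulr1; lra.
Qed.

Definition gamma_weight s t : R := t `^ (s - 1) * expR (- t).

Lemma gamma_weight_ge0 s t : 0 <= gamma_weight s t.
Proof. by rewrite mulr_ge0 ?powR_ge0 ?expR_ge0. Qed.

Lemma gamma_weightE s t : 0 < t ->
  gamma_weight s t = expR ((s - 1) * ln t - t).
Proof. by move=> t0; rewrite /gamma_weight powR_expR// -expRD. Qed.

Lemma gamma_weightS s t : 0 < t -> gamma_weight (s + 1) t = t * gamma_weight s t.
Proof.
move=> t0; rewrite !gamma_weightE//.
rewrite (_ : (s + 1 - 1) * ln t - t = ln t + ((s - 1) * ln t - t)); last by ring.
by rewrite expRD lnK ?posrE.
Qed.

Lemma measurable_gamma_weight s D :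
  measurable_fun D (fun t : RR => gamma_weight s t).
Proof.
apply/measurable_funTS; apply: measurable_funM; first exact: measurable_powR.
exact: (measurableT_comp (@measurable_expR R) (@oppr_measurable R setT)).
Qed.

Lemma measurable_gamma_weightE s D :
  measurable_fun D (fun t : RR => (gamma_weight s t)%:E).
Proof. apply/measurable_EFinP; exact: measurable_gamma_weight. Qed.

Lemma is_derive_ln1D t : 0 < t ->
  is_derive t (1 : R) (fun u : R => ln (1 + u)) (1 + t)^-1.
Proof.
move=> t0; have t1 : 0 < 1 + t by rewrite addr_gt0.
have d1 : is_derive t (1 : R) (fun u : R => 1 + u) 1.
  by apply: is_derive_eq; rewrite add0r mulr1.
have := @is_derive1_comp R (@ln R) (fun u => 1 + u) t _ _ (is_derive1_ln t1) d1.
by rewrite mulr1.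
Qed.

(** Both ends are handled at once by comparison with the derivative of a bounded function: the
    derivative of [(t / (1 + t)) ^ s] is [s * t ^ (s - 1) / (1 + t) ^ (s + 1)], and [exp (- t)] is
    bounded by a multiple of [(1 + t) ^ (- (s + 1))]. *)
Lemma gamma_weight_lty s : 0 < s ->
  (\int[lam]_(t in pos) (gamma_weight s t)%:E < +oo)%E.
Proof.
move=> s0.
pose F t := expR (s * (ln t - ln (1 + t))).
pose f t := s * (t^-1 - (1 + t)^-1) * F t.
have dF t : 0 < t -> is_derive t (1 : R) F (f t).
  move=> t0; have := is_derive1_ln t0; have := is_derive_ln1D t0 => d1 d2.
  have d3 : is_derive t (1 : R) (fun t => s * (ln t - ln (1 + t)))
      (s * (t^-1 - (1 + t)^-1)).
    by apply: is_derive_eq.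
  have := @is_derive1_comp R (@expR R) _ t _ _ (is_derive_expR _) d3.
  by rewrite mulrC.
have cf t : 0 < t -> {for t, continuous f}.
  move=> t0; apply: cvgM; last first.
    apply/differentiable_continuous/derivable1_diffP.
    by have /@ex_derive := dF t t0.
  apply: cvgM; first exact: cvg_cst.
  apply: cvgB; first by apply: cvgV; [rewrite gt_eqF|exact: cvg_id].
  apply: cvgV; first by rewrite gt_eqF// addr_gt0.
  by apply: cvgD; [exact: cvg_cst|exact: cvg_id].
have f0 t : 0 < t -> 0 <= f t.
  move=> t0; rewrite mulr_ge0 ?expR_ge0// mulr_ge0 ?(ltW s0)// subr_ge0.
  by rewrite lef_pV2 ?posrE ?addr_gt0// lerDr.
have F1 t : 0 < t -> `|F t| <= 1.
  move=> t0; rewrite ger0_norm ?expR_ge0// -expR0 ler_expR.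
  rewrite mulr_ge0_le0 ?(ltW s0)// subr_le0 ler_ln ?posrE ?addr_gt0//.
  by rewrite lerDr.
have Fle := ge0_integral_pos_bounded dF cf f0 F1.
(* The bound of [(s + 1) * ln (1 + t) - t] given by [ln_le_linear] with [p = s + 1] at the point
   [1 + t]. *)
pose c := 1 + ((s + 1) * ln (s + 1) - (s + 1)).
have dom t : 0 < t -> gamma_weight s t <= expR c / s * f t.
  move=> t0; have t1 : 0 < 1 + t by rewrite addr_gt0.
  rewrite gamma_weightE// /f /F.
  have -> : t^-1 - (1 + t)^-1 = expR (- ln t - ln (1 + t)).
    rewrite expRD !expRN !lnK ?posrE//; field.
    by rewrite !gt_eqF.
  rewrite mulrA mulrA mulfVK ?gt_eqF// -!expRD ler_expR.
  have := @ln_le_linear (s + 1) (1 + t) (addr_gt0 s0 ltr01) t1.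
  rewrite /c; nra.
have mf : measurable_fun pos (fun t : RR => (f t)%:E).
  by apply/measurable_EFinP; exact: measurable_fun_pos_continuous cf.
apply: (@le_lt_trans _ _ (\int[lam]_(t in pos) ((expR c / s)%:E * (f t)%:E)))%E.
  apply: ge0_le_integral => //.
  - by move=> t _; rewrite lee_fin gamma_weight_ge0.
  - exact: measurable_gamma_weightE.
  - exact: measurable_funeM.
  - by move=> t; rewrite /= in_itv/= andbT => t0; rewrite -EFinM lee_fin dom.
rewrite ge0_integralZl//; last 2 first.
- by move=> t; rewrite /= in_itv/= andbT => t0; rewrite lee_fin f0.
- by rewrite lee_fin divr_ge0 ?expR_ge0// ltW.
rewrite lte_mul_pinfty// ?lee_fin ?divr_ge0 ?expR_ge0// ?(ltW s0)//.
exact: le_lt_trans Fle (ltry _).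
Qed.

(** Otherwise a positive function would vanish almost everywhere on a set of infinite measure. *)
Lemma gamma_weight_gt0 s : (0 < \int[lam]_(t in pos) (gamma_weight s t)%:E)%E.
Proof.
rewrite lt0e integral_ge0 ?andbT; last by move=> t _; rewrite lee_fin gamma_weight_ge0.
apply/negP => /eqP H.
have : (\int[lam]_(t in pos) `|(gamma_weight s t)%:E| = 0)%E.
  by rewrite -[RHS]H; apply: eq_integral => t _; rewrite gee0_abs// lee_fin gamma_weight_ge0.
move=> /(ae_eq_integral_abs lam (measurable_itv _) (@measurable_gamma_weightE s _)).1.
move=> [N [mN N0 sub]].
have : (lam pos <= lam N)%E.
  apply: le_measure; rewrite ?inE//.
  move=> t t0; apply: sub => /= /(_ t0) [] /eqP.
  move: t0; rewrite /= in_itv/= andbT => t0.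
  by rewrite gt_eqF// gamma_weightE// expR_gt0.
by rewrite N0 lebesgue_measure_itv/= ltry.
Qed.

Lemma integrable_gamma_weightM s (k : R -> R) : 0 < s ->
  measurable_fun setT (k : RR -> R) -> (forall t, `|k t| <= 1) ->
  lam.-integrable pos (fun t : RR => (gamma_weight s t * k t)%:E).
Proof.
move=> s0 mk k1; apply/integrableP; split.
  apply/measurable_EFinP; apply: measurable_funM; last exact: measurable_funTS.
  exact: measurable_gamma_weight.
apply: le_lt_trans (gamma_weight_lty s0); apply: ge0_le_integral => //.
- apply: measurableT_comp => //; apply/measurable_EFinP.
  apply: measurable_funM; last exact: measurable_funTS.
  exact: measurable_gamma_weight.
- exact: measurable_gamma_weightE.
- move=> t _; rewrite lee_fin normrM ger0_norm ?gamma_weight_ge0//.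
  by rewrite ler_piMr ?gamma_weight_ge0.
Qed.

(** With [gamma_sin], the real and imaginary parts of [exp (i phi) * Gamma (s + i y)]. The free
    phase turns sine into a shifted cosine, so that one functional equation suffices, and lets the
    direction of a lower bound be chosen. *)
Definition gamma_cos s y phi : R :=
  \int[lam]_(t in pos) (gamma_weight s t * cos (y * ln t + phi)).

Definition gamma_sin s y phi : R :=
  \int[lam]_(t in pos) (gamma_weight s t * sin (y * ln t + phi)).

Lemma measurable_phase y phi :
  measurable_fun setT (fun t : RR => y * ln t + phi : RR).
Proof.
apply: measurable_funD; last exact: measurable_cst.
by apply: measurable_funM; [exact: measurable_cst|exact: measurable_ln].
Qed.

Lemma measurable_cos_phase y phi :
  measurable_fun setT (fun t : RR => cos (y * ln t + phi)).
Proof.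
exact: (measurableT_comp (continuous_measurable_fun (@continuous_cos R))
  (measurable_phase y phi)).
Qed.

Lemma measurable_sin_phase y phi :
  measurable_fun setT (fun t : RR => sin (y * ln t + phi)).
Proof.
exact: (measurableT_comp (continuous_measurable_fun (@continuous_sin R))
  (measurable_phase y phi)).
Qed.

(** Integration by parts, written as the vanishing of the integral of a derivative: [F], which is
    [t ^ x * exp (- t)] times the cosine, tends to 0 at both ends, and its derivative [f] collects
    the three integrands. *)
Lemma gamma_cosS x y phi : 0 < x ->
  gamma_cos (x + 1) y phi = x * gamma_cos x y phi - y * gamma_sin x y phi.
Proof.
move=> x0.
pose E t := expR (x * ln t - t).
pose F t := E t * cos (y * ln t + phi).
pose f t := (x * t^-1 - 1) * E t * cos (y * ln t + phi)
            - y * t^-1 * E t * sin (y * ln t + phi).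
have dE t : 0 < t -> is_derive t (1 : R) E ((x * t^-1 - 1) * E t).
  move=> t0; have := is_derive1_ln t0 => d1.
  have d3 : is_derive t (1 : R) (fun t => x * ln t - t) (x * t^-1 - 1).
    by apply: is_derive_eq.
  have := @is_derive1_comp R (@expR R) _ t _ _ (is_derive_expR _) d3.
  by rewrite mulrC.
have dth t : 0 < t -> is_derive t (1 : R) (fun t => y * ln t + phi) (y * t^-1).
  by move=> t0; have := is_derive1_ln t0 => d1; apply: is_derive_eq; rewrite addr0.
have dc t : 0 < t -> is_derive t (1 : R) (fun t => cos (y * ln t + phi))
    (- sin (y * ln t + phi) * (y * t^-1)).
  by move=> t0; apply: (@is_derive1_comp R (@cos R) _ t _ _ (is_derive_cos _) (dth t t0)).
have ds t : 0 < t -> is_derive t (1 : R) (fun t => sin (y * ln t + phi))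
    (cos (y * ln t + phi) * (y * t^-1)).
  by move=> t0; apply: (@is_derive1_comp R (@sin R) _ t _ _ (is_derive_sin _) (dth t t0)).
have dF t : 0 < t -> is_derive t (1 : R) F (f t).
  move=> t0; have := dE t t0; have := dc t t0 => d1 d2.
  by apply: is_derive_eq; rewrite /f /GRing.scale/=; ring.
have cont (g : R -> R) dg t : is_derive t (1 : R) g dg -> {for t, continuous g}.
  move=> dgt; apply/differentiable_continuous/derivable1_diffP; exact: ex_derive.
have cf t : 0 < t -> {for t, continuous f}.
  move=> t0; have cV : {for t, continuous (fun t : R => t^-1)}.
    by apply: cvgV; [rewrite gt_eqF|exact: cvg_id].
  apply: cvgB; apply: cvgM; try exact: cont (dc t t0); try exact: cont (ds t t0).
    apply: cvgM; last exact: cont (dE t t0).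
    apply: cvgB; last exact: cvg_cst.
    by apply: cvgM; [exact: cvg_cst|exact: cV].
  apply: cvgM; last exact: cont (dE t t0).
  by apply: cvgM; [exact: cvg_cst|exact: cV].
have mpos : measurable pos by exact: measurable_itv.
have EW t : 0 < t -> E t = gamma_weight (x + 1) t.
  by move=> t0; rewrite gamma_weightE// addrK.
have x10 : 0 < x + 1 by rewrite addr_gt0.
have ic s : 0 < s -> lam.-integrable pos
    (fun t : RR => (gamma_weight s t * cos (y * ln t + phi))%:E).
  move=> s0; apply: integrable_gamma_weightM => //.
    exact: measurable_cos_phase.
  by move=> t; exact: cos_max.
have is_ : lam.-integrable pos
    (fun t : RR => (gamma_weight x t * sin (y * ln t + phi))%:E).
  apply: integrable_gamma_weightM => //; first exact: measurable_sin_phase.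
  by move=> t; exact: sin_max.
have ixc : lam.-integrable pos
    (fun t : RR => (x * (gamma_weight x t * cos (y * ln t + phi)))%:E).
  by have := integrableZl mpos x (ic x x0).
have iys : lam.-integrable pos
    (fun t : RR => (y * (gamma_weight x t * sin (y * ln t + phi)))%:E).
  by have := integrableZl mpos y is_.
have ixcb : lam.-integrable pos (fun t : RR =>
    (x * (gamma_weight x t * cos (y * ln t + phi)) -
     gamma_weight (x + 1) t * cos (y * ln t + phi))%:E).
  by have := integrableB mpos ixc (ic _ x10).
pose f' t := x * (gamma_weight x t * cos (y * ln t + phi)) -
     gamma_weight (x + 1) t * cos (y * ln t + phi) -
     y * (gamma_weight x t * sin (y * ln t + phi)).
have ff' t : t \in pos -> f t = f' t.
  rewrite inE/= in_itv/= andbT => t0; rewrite /f /f' EW// gamma_weightS//.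
  by field; rewrite gt_eqF.
have fi : lam.-integrable pos (fun t : RR => (f t)%:E).
  apply: (eq_integrable mpos (fun t : RR => (f' t)%:E)).
    by move=> t tpos; rewrite ff'.
  by have := integrableB mpos ixcb iys.
have FE t : `|F t| <= E t.
  by rewrite normrM ger0_norm ?expR_ge0// ler_piMr ?expR_ge0// cos_max.
(* At infinity [t ^ x * exp (- t)] is at most [c / t], by the tangent bound with exponent
   [x + 1]. *)
have Fy : F k.+1%:R @[k --> \oo] --> (0 : R).
  pose c := expR ((x + 1) * ln (x + 1) - (x + 1)).
  have hc : c * (k.+1%:R^-1 : R) @[k --> \oo] --> (0 : R).
    by rewrite -(mulr0 c); apply: cvgM; [exact: cvg_cst|exact: cvg_harmonic].
  apply: (@squeeze_cvgr _ _ _ _ (fun k => - (c * k.+1%:R^-1)) (fun k => c * k.+1%:R^-1)) => //.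
    apply: nearW => k; rewrite -ler_norml (le_trans (FE _))//.
    rewrite -[k.+1%:R^-1](@lnK R) ?posrE ?invr_gt0// -expRD ler_expR.
    rewrite lnV ?posrE//.
    have := @ln_le_linear (x + 1) k.+1%:R x10 (ltr0Sn _ _); lra.
  by rewrite -oppr0; exact: cvgN.
(* Near 0 the bound [t ^ x] suffices, because [x] is positive. *)
have F0 : F k.+1%:R^-1 @[k --> \oo] --> (0 : R).
  have hc : (k.+1%:R^-1 : R) `^ x @[k --> \oo] --> (0 : R).
    have /cvg_at_rightP := powR_cvg0 x0; apply; split.
      by move=> k; rewrite invr_gt0.
    exact: cvg_harmonic.
  apply: (@squeeze_cvgr _ _ _ _ (fun k => - (k.+1%:R^-1 `^ x)) (fun k => k.+1%:R^-1 `^ x)) => //.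
    apply: nearW => k; rewrite -ler_norml (le_trans (FE _))//.
    rewrite powR_expR ?invr_gt0// ler_expR gerDl oppr_le0 invr_ge0//.
  by rewrite -oppr0; exact: cvgN.
have := integral_pos_derive_eq0 dF cf fi Fy F0.
move=> /(congr1 fine) /= H0.
have H : \int[lam]_(t in pos) f' t = 0.
  by rewrite -[RHS]H0; apply: eq_Rintegral => t tpos; rewrite -ff'.
have : \int[lam]_(t in pos) f' t =
    x * gamma_cos x y phi - gamma_cos (x + 1) y phi - y * gamma_sin x y phi.
  rewrite (RintegralB mpos ixcb iys) (RintegralB mpos ixc (ic _ x10)).
  by rewrite (RintegralZl x mpos (ic _ x0)) (RintegralZl y mpos is_).
by rewrite H => /esym/eqP; rewrite addrAC subr_eq0 => /eqP.
Qed.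

End gamma_integrand.

(** * Absence of zeros of Gamma in the right half-plane *)

Section gamma_nonvanishing.
Variable R : realType.
Local Notation RR := (measurableTypeR R).
Local Notation lam := (@lebesgue_measure R).
Local Notation pos := (`]0, +oo[%classic : set RR).
Implicit Types (s t x y phi : R).

Let mpos : measurable pos. Proof. exact: measurable_itv. Qed.

Lemma integrable_gamma_weight s : 0 < s ->
  lam.-integrable pos (fun t : RR => (gamma_weight s t)%:E).
Proof.
move=> s0; apply/integrableP; split; first exact: measurable_gamma_weightE.
apply: le_lt_trans (gamma_weight_lty s0); rewrite le_eqVlt; apply/orP; left.
by apply/eqP/eq_integral => t _; rewrite gee0_abs// lee_fin gamma_weight_ge0.
Qed.

Lemma integrable_gamma_cos s y phi : 0 < s -> lam.-integrable pos
  (fun t : RR => (gamma_weight s t * cos (y * ln t + phi))%:E).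
Proof.
move=> s0; apply: integrable_gamma_weightM => //; first exact: measurable_cos_phase.
by move=> t; exact: cos_max.
Qed.

Lemma integrable_gamma_sin s y phi : 0 < s -> lam.-integrable pos
  (fun t : RR => (gamma_weight s t * sin (y * ln t + phi))%:E).
Proof.
move=> s0; apply: integrable_gamma_weightM => //; first exact: measurable_sin_phase.
by move=> t; exact: sin_max.
Qed.

Lemma gamma_cos_phase s y phi : 0 < s ->
  gamma_cos s y phi = gamma_cos s y 0 * cos phi - gamma_sin s y 0 * sin phi.
Proof.
move=> s0; rewrite /gamma_cos /gamma_sin.
have ic := integrable_gamma_cos y 0 s0; have is_ := integrable_gamma_sin y 0 s0.
rewrite -(RintegralZr (cos phi) mpos ic) -(RintegralZr (sin phi) mpos is_).
rewrite -RintegralB//; last 2 first.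
- by have := integrableZr mpos (cos phi) ic.
- by have := integrableZr mpos (sin phi) is_.
by apply: eq_Rintegral => t _; rewrite !addr0 cosD; ring.
Qed.

Lemma gamma_sin_cos s y phi : gamma_sin s y phi = gamma_cos s y (phi - pi / 2).
Proof. by apply: eq_Rintegral => t _; rewrite addrA cosBpihalf. Qed.

Lemma gamma_cos_gt0 s : 0 < s -> 0 < gamma_cos s 0 0.
Proof.
move=> s0; rewrite /gamma_cos.
rewrite (_ : Rintegral _ _ _ = \int[lam]_(t in pos) gamma_weight s t); last first.
  by apply: eq_Rintegral => t _; rewrite mul0r addr0 cos0 mulr1.
by apply: fine_gt0; rewrite gamma_weight_gt0 gamma_weight_lty.
Qed.

Lemma gamma_real_int s : \int[lam]_(t in pos) gamma_weight s t = gamma_cos s 0 0.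
Proof. by apply: eq_Rintegral => t _; rewrite mul0r addr0 cos0 mulr1. Qed.

Lemma gamma_realS s : 0 < s -> gamma_cos (s + 1) 0 0 = s * gamma_cos s 0 0.
Proof. by move=> s0; rewrite gamma_cosS// mul0r subr0. Qed.

Lemma norm_sin_le x : `|sin x| <= `|x|.
Proof.
wlog x0 : x / 0 <= x => [H|].
  have [/H//|xlt0] := leP 0 x; rewrite -normrN -sinN -(normrN x).
  by apply: H; rewrite oppr_ge0 ltW.
move: x0; rewrite le_eqVlt => /predU1P[<-|x0]; first by rewrite sin0.
have [|c _] := @MVT R (@sin R) (@cos R) 0 x x0.
  by apply: continuous_subspaceT => t; exact: continuous_sin.
by rewrite sin0 !subr0 => ->; rewrite normrM ler_piMl// cos_max.
Qed.

Lemma cos_ge_quadratic x : 1 - x ^+ 2 / 2 <= cos x.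
Proof.
have -> : x = (x / 2) *+ 2 by rewrite mulr2n; lra.
rewrite cos_mulr2n cos2sin2; set u := x / 2.
have : sin u ^+ 2 <= u ^+ 2.
  by rewrite -[leLHS]real_normK ?num_real// -[leRHS]real_normK ?num_real//
    lerXn2r ?nnegrE// norm_sin_le.
rewrite (mulr2n u) (mulr2n (1 - sin u ^+ 2)).
have -> : (u + u) ^+ 2 / 2 = 2 * u ^+ 2 by field.
lra.
Qed.

(** With [h = ln r / 2] the right side is [4 * (exp h - exp (- h)) ^ 2], and [|h|] is at most
    [|exp h - exp (- h)|]. A bound in [r] and its inverse is wanted because these only shift the
    index of [gamma_weight]. *)
Lemma ln_sqr_le (r : R) : 0 < r -> ln r ^+ 2 <= 4 * (r - 2 + r^-1).
Proof.
move=> r0; pose h := ln r / 2; have rE : r = expR h * expR h.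
  by rewrite -expRD (_ : h + h = ln r) ?lnK ?posrE// /h; lra.
have lnE : ln r = 2 * h by rewrite /h; lra.
have e0 : expR h != 0 by rewrite gt_eqF ?expR_gt0.
have -> : r - 2 + r^-1 = (expR h - (expR h)^-1) ^+ 2 by rewrite rE; field.
rewrite lnE exprMn -natrX ler_pM2l//.
rewrite -[leLHS]real_normK ?num_real// -[leRHS]real_normK ?num_real//.
rewrite lerXn2r ?nnegrE// -expRN.
have key (u : R) : 0 <= u -> u <= expR u - expR (- u).
  move=> u0; have := expR_ge1Dx u; have : expR (- u) <= 1.
    by rewrite -expR0 ler_expR oppr_le0.
  lra.
have [h0|h0] := leP 0 h.
  by rewrite ger0_norm// (le_trans (key _ h0))// ler_norm.
have h0' : 0 <= - h by lra.
by rewrite -[leLHS]normrN (ger0_norm h0') (le_trans (key _ h0'))// opprK -normrN opprB ler_norm.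
Qed.

Lemma cos_ln_ge s t y : 0 < s -> 0 < t ->
  1 - 2 * y ^+ 2 * (t / s - 2 + s / t) <= cos (y * ln t + - (y * ln s)).
Proof.
move=> s0 t0; have ts : 0 < t / s by rewrite divr_gt0.
have -> : y * ln t + - (y * ln s) = y * ln (t / s) by rewrite ln_div ?posrE//; ring.
apply: le_trans (cos_ge_quadratic _).
have := ln_sqr_le ts; rewrite invf_div exprMn => H.
have : y ^+ 2 * ln (t / s) ^+ 2 <= y ^+ 2 * (4 * (t / s - 2 + s / t)).
  by rewrite ler_wpM2l// sqr_ge0.
lra.
Qed.

(* The mass of [gamma_weight s] concentrates near [t = s]: the quadratic lower
   bound [cos_ln_ge] of the phase integrates in closed form through
   [gamma_realS]. *)
Lemma gamma_cos_phase_gt0 s y : 1 < s -> 2 * y ^+ 2 < s - 1 ->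
  0 < gamma_cos s y (- (y * ln s)).
Proof.
move=> s1 sy; have s0 : 0 < s by rewrite (lt_trans ltr01).
have s10 : 0 < s - 1 by rewrite subr_gt0.
have s20 : 0 < s + 1 by rewrite addr_gt0.
(* The coefficients of the weights of index [s], [s + 1] and [s - 1] when the lower bound of
   [cos_ln_ge] is multiplied out; [b] and [c] enter with a minus sign. *)
pose a := 1 + 4 * y ^+ 2; pose b := 2 * y ^+ 2 / s; pose c := 2 * y ^+ 2 * s.
have i1 : lam.-integrable pos (fun t : RR => (a * gamma_weight s t)%:E).
  by have := integrableZl mpos a (integrable_gamma_weight s0).
have i2 : lam.-integrable pos (fun t : RR => (b * gamma_weight (s + 1) t)%:E).
  by have := integrableZl mpos b (integrable_gamma_weight s20).
have i3 : lam.-integrable pos (fun t : RR => (c * gamma_weight (s - 1) t)%:E).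
  by have := integrableZl mpos c (integrable_gamma_weight s10).
have i12 : lam.-integrable pos
    (fun t : RR => (a * gamma_weight s t - b * gamma_weight (s + 1) t)%:E).
  by have := integrableB mpos i1 i2.
have i123 : lam.-integrable pos (fun t : RR =>
    (a * gamma_weight s t - b * gamma_weight (s + 1) t
     - c * gamma_weight (s - 1) t)%:E).
  by have := integrableB mpos i12 i3.
(* Under the normalized weight [t / s] has mean 1 and [s / t] has mean [s / (s - 1)], so
   [t / s - 2 + s / t] has mean [1 / (s - 1)]. *)
have lowE : \int[lam]_(t in pos) (a * gamma_weight s t
    - b * gamma_weight (s + 1) t - c * gamma_weight (s - 1) t) =
    gamma_cos s 0 0 * (1 - 2 * y ^+ 2 / (s - 1)).
  rewrite (RintegralB mpos i12 i3) (RintegralB mpos i1 i2).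
  rewrite (RintegralZl _ mpos (integrable_gamma_weight s0)).
  rewrite (RintegralZl _ mpos (integrable_gamma_weight s20)).
  rewrite (RintegralZl _ mpos (integrable_gamma_weight s10)) !gamma_real_int.
  rewrite gamma_realS//; have := gamma_realS s10; rewrite subrK => ->.
  by rewrite /a /b /c; field; rewrite !gt_eqF.
have : gamma_cos s 0 0 * (1 - 2 * y ^+ 2 / (s - 1)) <= gamma_cos s y (- (y * ln s)).
  rewrite -lowE; apply: le_Rintegral => //; first exact: integrable_gamma_cos.
  move=> t; rewrite /= in_itv/= andbT => t0.
  have -> : a * gamma_weight s t - b * gamma_weight (s + 1) t
      - c * gamma_weight (s - 1) t =
      gamma_weight s t * (1 - 2 * y ^+ 2 * (t / s - 2 + s / t)).
    rewrite gamma_weightS//; have := gamma_weightS (s - 1) t0; rewrite subrK => ->.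
    by rewrite /a /b /c; field; rewrite !gt_eqF.
  by rewrite ler_wpM2l ?gamma_weight_ge0// cos_ln_ge.
apply: lt_le_trans; rewrite mulr_gt0 ?gamma_cos_gt0// subr_gt0.
by rewrite ltr_pdivrMr// mul1r.
Qed.

Lemma Re_cpow t (z : R[i]) : complex.Re (cpow t z) =
  t `^ complex.Re z * cos (complex.Im z * ln t).
Proof. by rewrite /cpow complex_ReM/= mul0r subr0. Qed.

Lemma Im_cpow t (z : R[i]) : complex.Im (cpow t z) =
  t `^ complex.Re z * sin (complex.Im z * ln t).
Proof. by rewrite /cpow complex_ImM/= mul0r addr0. Qed.

Lemma cGammaE (z : R[i]) : cGamma z =
  gamma_cos (complex.Re z) (complex.Im z) 0 +i*
  gamma_sin (complex.Re z) (complex.Im z) 0.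
Proof.
rewrite /cGamma /cintegral; case: z => x y.
congr (_ +i* _); apply: eq_Rintegral => t _.
  by rewrite complex_ReMr Re_cpow /gamma_weight/= subr0 addr0 mulrAC.
by rewrite complex_ImMr Im_cpow /gamma_weight/= subr0 addr0 mulrAC.
Qed.

(* A zero at [z] would propagate to all [z + k] by the functional equation,
   against [gamma_cos_phase_gt0]. *)
Lemma cGamma_neq0 (z : R[i]) : 0 < complex.Re z -> cGamma z != 0.
Proof.
case: z => x y /= x0; rewrite cGammaE/=; apply/negP => /eqP[gc gs].
(* The phase is generalized in the induction, since the functional equation for the cosine involves
   the sine, that is, another phase. *)
have all0 k phi : gamma_cos (x + k%:R) y phi = 0.
  elim: k phi => [|k IH] phi.
    by rewrite addr0 gamma_cos_phase// gc gs !mul0r subrr.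
  have xk : 0 < x + k%:R by rewrite ltr_pwDl.
  by rewrite -natr1 addrA gamma_cosS// gamma_sin_cos !IH !mulr0 subrr.
pose k := (Num.truncn (1 + 2 * y ^+ 2)).+1.
have hk : 1 + 2 * y ^+ 2 < x + k%:R.
  by apply: lt_trans (truncnS_gt _) _; rewrite ltrDr.
have y0 : 0 <= 2 * y ^+ 2 by rewrite mulr_ge0// sqr_ge0.
have := @gamma_cos_phase_gt0 (x + k%:R) y.
by rewrite all0 ltxx => H; suff : false by []; apply: H; lra.
Qed.

End gamma_nonvanishing.

(** * Complex powers *)

Section complex_powers.
Variable R : realType.
Local Notation RR := (measurableTypeR R).
Local Notation lam := (@lebesgue_measure R).
Local Notation gau := (@gauss_fun R).
Local Notation pos := (`]0, +oo[%classic : set RR).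
Implicit Types (x y r : R) (z w : R[i]).

Lemma normc_cpow x z : normc (cpow x z) = x `^ complex.Re z.
Proof.
rewrite /cpow normcM normc_real ger0_norm ?powR_ge0//=.
by rewrite cos2Dsin2 sqrtr1 mulr1.
Qed.

Lemma cpow_neq0 x z : 0 < x -> cpow x z != 0.
Proof.
move=> x0; apply/eqP => /(congr1 (@normc R)).
by rewrite normc_cpow normc0; apply/eqP; rewrite gt_eqF// powR_gt0.
Qed.

Lemma cpowM x y z : 0 < x -> 0 < y -> cpow (x * y) z = cpow x z * cpow y z.
Proof.
move=> x0 y0; apply/eqP.
rewrite eq_complex (complex_ReM (cpow x z)) (complex_ImM (cpow x z)).
rewrite !Re_cpow !Im_cpow.
rewrite powRM ?ltW// lnM ?posrE// mulrDr cosD sinD.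
by apply/andP; split; apply/eqP; ring.
Qed.

Lemma cpowD x z w : 0 < x -> cpow x (z + w) = cpow x z * cpow x w.
Proof.
move=> x0; apply/eqP.
rewrite eq_complex (complex_ReM (cpow x z)) (complex_ImM (cpow x z)).
rewrite !Re_cpow !Im_cpow.
case: z w => [a b] [c d] /=.
rewrite powRD; last by rewrite (gt_eqF x0) implybT.
rewrite mulrDl cosD sinD.
by apply/andP; split; apply/eqP; ring.
Qed.

Lemma cpow_real x r : cpow x r%:C = (x `^ r)%:C.
Proof.
apply/eqP; rewrite eq_complex Re_cpow Im_cpow /= mul0r cos0 sin0.
by rewrite mulr1 mulr0 !eqxx.
Qed.

Lemma cpow1l z : cpow 1 z = 1.
Proof.
apply/eqP; rewrite eq_complex Re_cpow Im_cpow ln1 mulr0 cos0 sin0 powR1/=.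
by rewrite mulr1 mulr0 !eqxx.
Qed.

Lemma cpow1 x : 0 < x -> cpow x 1 = x%:C.
Proof. by move=> x0; have := cpow_real x 1; rewrite powRr1 ?ltW. Qed.

Lemma cpow_nat x k : 0 < x -> cpow x k%:R = (x ^+ k)%:C.
Proof.
move=> x0; have := cpow_real x k%:R; rewrite powR_mulrn ?ltW// => <-.
by rewrite rmorph_nat.
Qed.

Lemma cpow_sqr x z : 0 < x -> cpow (x ^+ 2) z = cpow x (2 * z).
Proof. by move=> x0; rewrite expr2 cpowM// -cpowD// mulr_natl mulr2n. Qed.

Lemma complex_measurable_cpow d (T : measurableType d) (f : T -> RR) z :
  measurable_fun setT f -> complex_measurable (fun t => cpow (f t) z).
Proof.
move=> mf.
have mp := measurableT_comp (@measurable_powR R (complex.Re z)) mf.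
have mph := measurableT_comp (measurable_phase (complex.Im z) 0) mf.
split.
  rewrite (_ : (fun t => _) = fun t =>
      f t `^ complex.Re z * cos (complex.Im z * ln (f t) + 0)).
    apply: measurable_funM; first exact: mp.
    exact: (measurableT_comp (continuous_measurable_fun (@continuous_cos R)) mph).
  by apply/funext => t; rewrite Re_cpow addr0.
rewrite (_ : (fun t => _) = fun t =>
    f t `^ complex.Re z * sin (complex.Im z * ln (f t) + 0)).
  apply: measurable_funM; first exact: mp.
  exact: (measurableT_comp (continuous_measurable_fun (@continuous_sin R)) mph).
by apply/funext => t; rewrite Im_cpow addr0.
Qed.

(* Unlike [cpow], it vanishes at 0 for every exponent, hence is multiplicative
   on the whole line. *)
Definition abs_cpow z (r : R) : R[i] := if r == 0 then 0 else cpow `|r| z.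

Lemma abs_cpowM z r x : abs_cpow z (r * x) = abs_cpow z r * abs_cpow z x.
Proof.
rewrite /abs_cpow mulf_eq0; have [_|r0] := eqVneq r 0; first by rewrite mul0r.
have [_|x0] := eqVneq x 0; first by rewrite mulr0.
by rewrite normrM cpowM// normr_gt0.
Qed.

Lemma abs_cpow_gt0 z x : 0 < x -> abs_cpow z x = cpow x z.
Proof. by move=> x0; rewrite /abs_cpow gt_eqF// gtr0_norm. Qed.

Lemma complex_measurable_abs_cpow d (T : measurableType d) (f : T -> RR) z :
  measurable_fun setT f -> complex_measurable (fun t => abs_cpow z (f t)).
Proof.
move=> mf; pose k (r : RR) : R := \1_(~` [set 0]) r.
have mk : measurable_fun setT (fun t => k (f t)).
  apply: (measurableT_comp _ mf); apply: measurable_indic.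
  by apply: measurableC; exact: measurable_set1.
have mn := measurableT_comp (@normr_measurable R setT) mf.
have := complex_measurableM (complex_measurable_cpow z mn) (complex_measurable_real mk).
suff -> : (fun t => abs_cpow z (f t)) =
    (fun t => cpow `|f t| z * (k (f t))%:C) by [].
apply/funext => t; rewrite /abs_cpow /k indicE.
have [->|ft0] := eqVneq (f t) 0; first by rewrite memNset ?mulr0//=; apply.
by rewrite mem_set ?mulr1//=; exact/eqP.
Qed.

(** The substitution [s = r ^ 2], with [|r| ^ (2 z - 1)] written as [(r ^ 2) ^ (z - 1) * |r|]. The
    whole line covers the half-line twice, which compensates the 2 in [ds = 2 r dr]. *)
Lemma cintegral_abs_cpow_gauss z :
  cintegral lam setT (fun r : RR => abs_cpow (2 * z - 1) r * (gau r)%:C) =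
  cGamma z.
Proof.
pose h (s : RR) := cpow s (z - 1) * (expR (- s))%:C.
have mh : complex_measurable h.
  apply: complex_measurableM; first exact: complex_measurable_cpow.
  apply: complex_measurable_real.
  exact: (measurableT_comp (@measurable_expR R) (@oppr_measurable R setT)).
have hyp (g : RR -> \bar R) : measurable_fun setT g -> (forall u, 0 <= g u)%E ->
    (\int[lam]_r (g (r ^+ 2)%R * (`|r|)%:E) =
     \int[lam]_s (g s * (\1_pos s)%:E))%E.
  move=> mg g0; rewrite ge0_integral_sqr// integral_mkcond.
  by apply: eq_integral => s _; rewrite epatch_indic.
have pos1 (s : RR) : 0 <= \1_pos s :> R by rewrite indicE.
have H := cintegral_transfer (mu := lam) (nu := lam)
  (phi := fun r : RR => r ^+ 2 : RR) (psi := fun s : RR => s)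
  (v := fun r : RR => `|r|) (w := \1_pos) (fun r => normr_ge0 r) pos1 hyp mh.
transitivity (cintegral lam setT (fun r : RR => h (r ^+ 2) * (`|r|)%:C)).
  congr cintegral; apply/funext => r; rewrite /h /abs_cpow.
  have [->|r0] := eqVneq r 0; first by rewrite normr0 mulr0 mul0r.
  have p0 : 0 < `|r| by rewrite normr_gt0.
  have -> : 2 * z - 1 = 2 * (z - 1) + 1 by ring.
  rewrite (cpowD (2 * (z - 1)) 1 p0) (cpow1 p0) -(cpow_sqr (z - 1) p0).
  by rewrite real_normK ?num_real// /gauss_fun mulrAC.
rewrite H /cGamma /cintegral; congr (_ +i* _).
  rewrite [RHS]Rintegral_mkcond; apply: eq_Rintegral => s _.
  by rewrite complex_ReMr patch_indic.
rewrite [RHS]Rintegral_mkcond; apply: eq_Rintegral => s _.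
by rewrite complex_ImMr patch_indic.
Qed.

Lemma integral_normc_abs_cpow_gauss z :
  (\int[lam]_r (normc (abs_cpow (2 * z - 1) r) * gau r)%:E =
   \int[lam]_(t in pos) (gamma_weight (complex.Re z) t)%:E)%E.
Proof.
rewrite -ge0_integral_sqr//; last 2 first.
- exact: measurable_gamma_weightE.
- by move=> r; rewrite lee_fin gamma_weight_ge0.
apply: eq_integral => r _; rewrite -EFinM; congr _%:E; rewrite /abs_cpow.
have [->|r0] := eqVneq r 0; first by rewrite normr0 mulr0 normc0 mul0r.
have p0 : 0 < `|r| by rewrite normr_gt0.
have p20 : 0 < r ^+ 2 by rewrite exprn_even_gt0.
rewrite normc_cpow /gauss_fun powR_expR// gamma_weightE//.
rewrite -[in RHS](real_normK (num_real r)) lnXn//.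
rewrite -[X in _ = _ * X](lnK p0) -!expRD; congr expR.
have -> : complex.Re (2 * z - 1) = 2 * complex.Re z - 1.
  by case: z => a b; rewrite /=; ring.
by rewrite real_normK ?num_real// mulr2n; ring.
Qed.

End complex_powers.

(** * The two kernels *)

Lemma pos_fineE (R : realType) (e : \bar R) :
  (0 < e)%E -> (e < +oo)%E -> e = (fine e)%:E /\ 0 < fine e.
Proof. by case: e. Qed.

Section kernel.
Variables (R : realType) (n : nat) (eps : R) (alpha : R[i]).
Hypotheses (eps0 : 0 <= eps) (ha : 0 < complex.Re alpha).
Local Notation RR := (measurableTypeR R).
Local Notation lam := (@lebesgue_measure R).
Local Notation gau := (@gauss_fun R).
Local Notation h := (abs_cpow (alpha - 1)).
Local Notation hw := (hyperplane_weight eps).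
Local Notation pw := (point_weight eps).
(** The weight on hyperplanes, arranged as in [kernel_law]: of the [alpha + n] powers of [hw] in the
    denominator, [alpha - 1] sit inside [h] and [n + 1] outside. *)
Definition hyperplane_kernel (ab : Rvec R n * RR) : R[i] :=
  h (ab.2 / hw ab.1 ab.2) * (hw ab.1 ab.2 ^- n.+1)%:C.

(** The weight on points in the form produced by the right side of [kernel_law]: of the [alpha]
    powers of [pw], [alpha - 1] sit inside [h]. *)
Definition point_kernel (x : Rvec R n.+1) : R[i] :=
  h (Num.sqrt (dot x x) * pw (dot x x)) * (pw (dot x x))%:C.

Lemma complex_measurable_hyperplane_kernel : complex_measurable hyperplane_kernel.
Proof.
have mw := measurable_hyperplane_weight eps (@measurable_fst _ _ (Rvec R n) RR)
  (@measurable_snd _ _ (Rvec R n) RR).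
have mwV (k : nat) : measurable_fun setT
    (fun z : Rvec R n * RR => (hw z.1 z.2) ^- k : RR).
  rewrite (_ : (fun z => _) = fun z => (hw z.1 z.2) `^ (- k%:R)).
    exact: (measurableT_comp (@measurable_powR R _) mw).
  by apply/funext => z; rewrite powR_invn// ltW// hyperplane_weight_gt0.
apply: complex_measurableM; last by apply: complex_measurable_real; exact: mwV.
apply: complex_measurable_abs_cpow; apply: measurable_funM => //.
by have := mwV 1%N; under eq_fun do rewrite expr1.
Qed.

Lemma complex_measurable_point_kernel : complex_measurable point_kernel.
Proof.
have md : measurable_fun setT (fun x : Rvec R n.+1 => dot x x : RR).
  exact: measurable_dot.
have ms (f : Rvec R n.+1 -> RR) : measurable_fun setT f ->
    measurable_fun setT (fun x => Num.sqrt (f x) : RR).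
  exact: (measurableT_comp (continuous_measurable_fun (@sqrt_continuous R))).
have mp : measurable_fun setT (fun x : Rvec R n.+1 => pw (dot x x) : RR).
  rewrite (_ : (fun x => _) = fun x : Rvec R n.+1 =>
      (Num.sqrt (1 + eps * dot x x)) `^ (- 1)).
    apply: (measurableT_comp (@measurable_powR R _)); apply: ms.
    apply: measurable_funD; first exact: measurable_cst.
    by apply: measurable_funM => //; exact: measurable_cst.
  by apply/funext => x; rewrite powR_inv1// sqrtr_ge0.
apply: complex_measurableM; last exact: complex_measurable_real.
by apply: complex_measurable_abs_cpow; apply: measurable_funM => //; exact: ms.
Qed.

Lemma normc_hyperplane_kernel ab : normc (hyperplane_kernel ab) =
  normc (h (ab.2 / hw ab.1 ab.2)) * hw ab.1 ab.2 ^- n.+1.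
Proof.
rewrite normcM normc_real ger0_norm// invr_ge0 exprn_ge0// ltW//.
exact: hyperplane_weight_gt0.
Qed.

Lemma normc_point_kernel x : normc (point_kernel x) =
  normc (h (Num.sqrt (dot x x) * pw (dot x x))) * pw (dot x x).
Proof. by rewrite normcM normc_real ger0_norm// ltW// point_weight_gt0// dot_ge0. Qed.

Definition radial_weight (k : nat) (r : RR) : R := `|r| ^+ k * gau r.

(** This is Gamma at the real part of [(alpha + k) / 2], which [gauss_momentP] shows to be positive
    and finite. *)
Definition gauss_moment (k : nat) : R :=
  fine (\int[lam]_r (normc (h r) * radial_weight k r)%:E)%E.

Lemma radial_weight_ge0 k r : 0 <= radial_weight k r.
Proof. by rewrite mulr_ge0 ?exprn_ge0 ?gauss_fun_ge0. Qed.

Lemma measurable_radial_weight k : measurable_fun setT (radial_weight k).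
Proof.
apply: measurable_funM; first by apply: measurable_funX; exact: normr_measurable.
exact: measurable_gauss (@measurable_id _ _ _).
Qed.

Lemma complex_measurable_h : complex_measurable (h : RR -> R[i]).
Proof. exact: complex_measurable_abs_cpow (@measurable_id _ _ _). Qed.

Lemma measurable_normc_h : measurable_fun setT (fun r : RR => normc (h r)).
Proof. exact: complex_measurable_normc complex_measurable_h. Qed.

Lemma abs_cpow_exprn k (r : RR) : h r * (`|r| ^+ k)%:C =
  abs_cpow (2 * ((alpha + k%:R) / 2) - 1) r.
Proof.
rewrite /abs_cpow; have [r0|r0] := eqVneq r 0; first by rewrite mul0r.
have p0 : 0 < `|r| by rewrite normr_gt0.
rewrite -cpow_nat// -(cpowD _ _ p0); congr cpow; by field.
Qed.

Lemma cintegral_radial_weight k :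
  cintegral lam setT (fun r : RR => h r * (radial_weight k r)%:C) =
  cGamma ((alpha + k%:R) / 2).
Proof.
rewrite -cintegral_abs_cpow_gauss; congr cintegral; apply/funext => r.
by rewrite -abs_cpow_exprn -mulrA -rmorphM.
Qed.

Lemma Re_gamma_index k : 0 < complex.Re ((alpha + k%:R) / 2).
Proof.
have -> : (alpha + k%:R) / 2 = (alpha + (k%:R)%:C) * (2^-1)%:C.
  by rewrite fmorphV !rmorph_nat.
rewrite complex_ReMr; have -> : complex.Re (alpha + (k%:R)%:C) =
  complex.Re alpha + k%:R by case: (alpha).
by rewrite divr_gt0// ltr_pwDl.
Qed.

Lemma gauss_momentP k :
  (\int[lam]_r (normc (h r) * radial_weight k r)%:E = (gauss_moment k)%:E)%E /\
  0 < gauss_moment k.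
Proof.
rewrite /gauss_moment (_ : (\int[lam]_r (normc (h r) * radial_weight k r)%:E)%E =
    (\int[lam]_(t in (`]0%R, +oo[%classic : set RR))
      (gamma_weight (complex.Re ((alpha + k%:R) / 2)) t)%:E)%E); last first.
  rewrite -integral_normc_abs_cpow_gauss; apply: eq_integral => r _.
  by rewrite -abs_cpow_exprn normcM normc_real normrX normr_id mulrA.
exact: pos_fineE (gamma_weight_gt0 _) (gamma_weight_lty (Re_gamma_index k)).
Qed.

Lemma gauss_moment_gt0 k : 0 < gauss_moment k.
Proof. by have [] := gauss_momentP k. Qed.

Lemma gauss_momentE k :
  (\int[lam]_r (normc (h r) * radial_weight k r)%:E = (gauss_moment k)%:E)%E.
Proof. by have [] := gauss_momentP k. Qed.

(** The value of [radon_lambda] with [alpha] replaced by its real part. *)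
Definition abs_kernel_constant : R :=
  Num.sqrt pi ^+ n * gauss_moment 0 / gauss_moment n.

Lemma abs_kernel_constant_gt0 : 0 < abs_kernel_constant.
Proof.
have m0 := gauss_moment_gt0 0; have mn := gauss_moment_gt0 n.
by rewrite divr_gt0// mulr_gt0// exprn_gt0// sqrtr_gt0 pi_gt0.
Qed.

Variables (x : Rvec R n) (t : R).
Local Notation v a := (t - dot a x).
Local Notation N := (dot x x + t ^+ 2).
Local Notation x1 := (adjoin (m := n.+1) x t).
Local Notation sg a := (hw a (v a)).

Lemma dot_adjoin_sqr : dot x1 x1 = N.
Proof. by rewrite dot_adjoin -expr2. Qed.

Lemma dotDsqr_ge0 : 0 <= N. Proof. by rewrite -dot_adjoin_sqr dot_ge0. Qed.

Lemma hyperplane_weight_expV_ge0 k (a : Rvec R n) (b : R) : 0 <= hw a b ^- k.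
Proof. by rewrite invr_ge0 exprn_ge0// ltW// hyperplane_weight_gt0. Qed.

Lemma measurable_hyperplane_weight_offset k :
  measurable_fun setT (fun a : Rvec R n => sg a ^- k : RR).
Proof.
have mw : measurable_fun setT (fun a : Rvec R n => sg a : RR).
  exact: measurable_hyperplane_weight (@measurable_id _ _ _) (measurable_offset _ _).
rewrite (_ : (fun a : Rvec R n => _) = fun a : Rvec R n => sg a `^ (- k%:R)).
  exact: (measurableT_comp (@measurable_powR R _) mw).
apply/funext => a; rewrite powR_invn//.
by rewrite ltW// hyperplane_weight_gt0.
Qed.

Lemma complex_measurable_kernel_offset :
  complex_measurable (fun a => hyperplane_kernel (a, v a)).
Proof.
have mav : measurable_fun setT (fun a : Rvec R n => (a, v a : RR)).
  apply: measurable_fun_pair; first exact: measurable_id.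
  exact: measurable_offset.
exact: complex_measurable_comp mav complex_measurable_hyperplane_kernel.
Qed.

Lemma measurable_offset_ratio :
  measurable_fun setT (fun a : Rvec R n => v a / sg a : RR).
Proof.
apply: measurable_funM; first exact: measurable_offset.
by have := measurable_hyperplane_weight_offset 1; under eq_fun do rewrite expr1.
Qed.

(** [kernel_law] for the modulus of [h]: multiplicativity splits the radial variable off on both
    sides, leaving [gauss_moment n] on the left and [gauss_moment 0] on the right. *)
Lemma integral_normc_hyperplane_kernel :
  (\int[lebesgue_vec R n]_a (normc (hyperplane_kernel (a, v a)))%:E =
   (abs_kernel_constant * normc (point_kernel x1))%:E)%E.
Proof.
have mn := measurable_normc_h; have mrw := measurable_radial_weight.
have mg : measurable_fun setT (fun r : RR => (normc (h r))%:E).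
  exact/measurable_EFinP.
have g0 (r : RR) : (0 <= (normc (h r))%:E)%E by rewrite lee_fin normc_ge0.
have K := @kernel_law R n eps eps0 x t _ mg g0.
have muN : measurable_fun setT (fun a => (normc (hyperplane_kernel (a, v a)))%:E).
  apply/measurable_EFinP; apply: complex_measurable_normc.
  exact: complex_measurable_kernel_offset.
have u0 a : (0 <= (normc (hyperplane_kernel (a, v a)))%:E)%E.
  by rewrite lee_fin normc_ge0.
have mhr k : measurable_fun setT (fun r : RR => (normc (h r) * radial_weight k r)%:E).
  by apply/measurable_EFinP; apply: measurable_funM.
have hr0 k r : (0 <= (normc (h r) * radial_weight k r)%:E)%E.
  by rewrite lee_fin mulr_ge0 ?normc_ge0 ?radial_weight_ge0.
have pi0 : 0 <= Num.sqrt pi ^+ n * normc (point_kernel x1) :> R.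
  by rewrite mulr_ge0 ?normc_ge0 ?exprn_ge0 ?sqrtr_ge0.
have gn0 := gauss_moment_gt0 n.
have gn0E : (0 <= (gauss_moment n)%:E)%E by rewrite lee_fin ltW.
have L : ((gauss_moment n)%:E *
    \int[lebesgue_vec R n]_a (normc (hyperplane_kernel (a, v a)))%:E =
    (Num.sqrt pi ^+ n * gauss_moment 0 * normc (point_kernel x1))%:E)%E.
  transitivity (\int[lam]_w ((normc (h (Num.sqrt N * pw N * w)))%:E *
     (Num.sqrt pi ^+ n * pw N * gau w)%:E))%E; last first.
    transitivity (\int[lam]_w ((Num.sqrt pi ^+ n * normc (point_kernel x1))%:E *
       (normc (h w) * radial_weight 0 w)%:E))%E.
      apply: eq_integral => w _; rewrite -!EFinM normc_point_kernel dot_adjoin_sqr.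
      by rewrite abs_cpowM normcM /radial_weight expr0; congr _%:E; ring.
    rewrite ge0_integralZl ?lee_fin//.
    by rewrite gauss_momentE -EFinM; congr _%:E; ring.
  rewrite -K -ge0_integralZl ?lee_fin//.
  apply: eq_integral => a _.
  transitivity (\int[lam]_r ((normc (hyperplane_kernel (a, v a)))%:E *
     (normc (h r) * radial_weight n r)%:E))%E.
    by rewrite ge0_integralZl// gauss_momentE muleC.
  apply: eq_integral => r _; rewrite -!EFinM normc_hyperplane_kernel/= (abs_cpowM (alpha - 1) r).
  by rewrite (normcM (h r)) /radial_weight; congr _%:E; ring.
rewrite -[LHS]mul1e -(mulVf (lt0r_neq0 gn0)) EFinM -muleA L -EFinM.
by rewrite /abs_kernel_constant; congr _%:E; ring.
Qed.

(** The same splitting for [h] itself yields [Gamma ((alpha + n) / 2)] times the kernel on the left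
    and [Gamma (alpha / 2)] times the weight of [x] on the right; the first factor is then
    cancelled. *)
Lemma cintegral_hyperplane_kernel :
  cintegral (lebesgue_vec R n) setT (fun a => hyperplane_kernel (a, v a)) =
  radon_lambda n.+1 alpha * point_kernel x1.
Proof.
have mh := complex_measurable_h; have ms := measurable_offset_ratio.
have mrw := measurable_radial_weight; have mB := measurable_hyperplane_weight_offset n.+1.
have muo := complex_measurable_kernel_offset.
have muN := complex_measurable_normc muo.
have Koo : (\int[lebesgue_vec R n]_a (normc (hyperplane_kernel (a, v a)))%:E < +oo)%E.
  by rewrite integral_normc_hyperplane_kernel ltry.
pose A := radial_weight n; pose B (a : Rvec R n) := sg a ^- n.+1; pose s (a : Rvec R n) : RR := v a / sg a.
have A0 r : 0 <= A r := radial_weight_ge0 n r.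
have B0 a : 0 <= B a := hyperplane_weight_expV_ge0 _ _ _.
have mphi : measurable_fun setT (fun z : Rvec R n * RR => z.2 * s z.1 : RR).
  apply: measurable_funM; first exact: measurable_snd.
  exact: (measurableT_comp ms measurable_fst).
have mwt : measurable_fun setT (fun z : Rvec R n * RR => A z.2 * B z.1 : RR).
  apply: measurable_funM; first exact: (measurableT_comp (mrw n) measurable_snd).
  exact: (measurableT_comp mB measurable_fst).
have w1 (z : Rvec R n * RR) : 0 <= A z.2 * B z.1 by rewrite mulr_ge0.
have w2 (w : RR) : 0 <= Num.sqrt pi ^+ n * pw N * gau w.
  rewrite mulr_ge0 ?gauss_fun_ge0// mulr_ge0 ?exprn_ge0 ?sqrtr_ge0//.
  by rewrite ltW// point_weight_gt0// dotDsqr_ge0.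
(* [cintegral_transfer] compares two single integrals, so the left side of [kernel_law] is read over
   the product measure. *)
have hyp (g : RR -> \bar R) : measurable_fun setT g -> (forall u, 0 <= g u)%E ->
    (\int[lebesgue_vec R n \x lam]_z (g (z.2 * s z.1)%R * (A z.2 * B z.1)%:E) =
     \int[lam]_w (g (Num.sqrt N * pw N * w)%R *
        (Num.sqrt pi ^+ n * pw N * gau w)%:E))%E.
  move=> mg g0; rewrite -(@kernel_law R n eps eps0 x t _ mg g0) fubini_tonelli1//.
  - apply: emeasurable_funM; first exact: (measurableT_comp mg mphi).
    exact/measurable_EFinP.
  - by move=> z; rewrite mule_ge0// lee_fin.
have T := cintegral_transfer (mu := (lebesgue_vec R n \x lam)%E) (nu := lam)
  (phi := fun z : Rvec R n * RR => z.2 * s z.1 : RR)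
  (psi := fun w : RR => Num.sqrt N * pw N * w : RR)
  (v := fun z : Rvec R n * RR => A z.2 * B z.1)
  (w := fun w : RR => Num.sqrt pi ^+ n * pw N * gau w) w1 w2 hyp mh.
have mhA k : complex_measurable (fun r : RR => h r * (radial_weight k r)%:C).
  by apply: complex_measurableM => //; exact: complex_measurable_real.
have hAoo k : (\int[lam]_r (normc (h r * (radial_weight k r)%:C))%:E < +oo)%E.
  under eq_integral do rewrite normcM normc_real (ger0_norm (radial_weight_ge0 _ _)).
  by rewrite gauss_momentE ltry.
have rhs : cintegral lam setT (fun w : RR => h (Num.sqrt N * pw N * w) *
      (Num.sqrt pi ^+ n * pw N * gau w)%:C) =
    (Num.sqrt pi ^+ n)%:C * point_kernel x1 * cGamma (alpha / 2).
  have := cintegral_radial_weight 0; rewrite addr0 => <-.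
  rewrite -(cintegralZl _ (mhA 0) (hAoo 0)); congr cintegral; apply/funext => w.
  rewrite abs_cpowM /point_kernel dot_adjoin_sqr /radial_weight expr0 mul1r.
  by rewrite !rmorphM; ring.
have lhs : cintegral (lebesgue_vec R n \x lam)%E setT
      (fun z => h (z.2 * s z.1) * (A z.2 * B z.1)%:C) =
    cGamma ((alpha + n%:R) / 2) * cintegral (lebesgue_vec R n) setT
      (fun a => hyperplane_kernel (a, v a)).
  rewrite -cintegral_fubini1; last 2 first.
  - apply: complex_measurableM; last exact: complex_measurable_real.
    exact: complex_measurable_abs_cpow.
  (* Integrating the modulus over [r] leaves [gauss_moment n] times the modulus of the kernel,
     already known to be integrable in [a]. *)
  - rewrite (_ : (\int[_]_x _)%E = (\int[lebesgue_vec R n]_a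
        ((normc (hyperplane_kernel (a, v a)))%:E * (gauss_moment n)%:E))%E).
      rewrite ge0_integralZr//.
      + by rewrite integral_normc_hyperplane_kernel -EFinM ltry.
      + exact/measurable_EFinP.
      + by move=> a _; rewrite lee_fin normc_ge0.
      + by rewrite lee_fin ltW// gauss_moment_gt0.
    apply: eq_integral => a _; rewrite -gauss_momentE -ge0_integralZl//; last 3 first.
    + apply/measurable_EFinP; apply: measurable_funM => //.
      exact: measurable_normc_h.
    + by move=> w _; rewrite lee_fin mulr_ge0 ?normc_ge0 ?radial_weight_ge0.
    + by rewrite lee_fin normc_ge0.
    apply: eq_integral => r _; rewrite -EFinM normc_hyperplane_kernel/=.
    rewrite abs_cpowM !normcM normc_real (ger0_norm (mulr_ge0 (A0 _) (B0 _))).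
    by congr _%:E; rewrite /B /A /s; ring.
  rewrite -(cintegralZl _ muo Koo); congr cintegral; apply/funext => a.
  rewrite -cintegral_radial_weight mulrC -(cintegralZl _ (mhA n) (hAoo n)).
  congr cintegral; apply/funext => r /=.
  by rewrite /hyperplane_kernel/= abs_cpowM /B /A /s rmorphM; ring.
rewrite lhs rhs in T.
have G0 : cGamma ((alpha + n%:R) / 2) != 0 by apply/cGamma_neq0/Re_gamma_index.
apply: (mulfI G0); rewrite T /radon_lambda /=.
have -> : (alpha + n.+1%:R - 1) / 2 = (alpha + n%:R) / 2.
  by rewrite -[n.+1]addn1 natrD addrA addrK.
have -> : pi `^ (n%:R / 2) = Num.sqrt pi ^+ n :> R.
  by rewrite mulrC powRrM powR12_sqrt ?pi_ge0// powR_mulrn// sqrtr_ge0.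
move: G0; move: (cGamma ((alpha + n%:R) / 2)) (cGamma (alpha / 2)) => c1 c2 G0.
by field.
Qed.

End kernel.

(** * The transversal Radon transform *)

Section radon_duality.
Variables (R : realType) (n : nat).
Local Notation RR := (measurableTypeR R).
Local Notation lam := (@lebesgue_measure R).
Local Notation leb := (lebesgue_vec R n).
Local Notation mu := (lebesgue_vec R n.+1).
Local Notation nu := (lebesgue_vec R n \x @lebesgue_measure R)%E.
Local Notation hp := (@hyperplane_point R n.+1).
Local Notation offset x a := (vlast x - dot a (vinit x)).

Lemma measurable_hyperplane_point :
  measurable_fun setT (fun z : (Rvec R n * RR) * Rvec R n => hp z.1 z.2).
Proof.
apply: measurable_adjoin2; first exact: measurable_snd.
apply: measurable_funD.
  apply: measurable_dot; last exact: measurable_snd.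
  exact: (measurableT_comp measurable_fst measurable_fst).
exact: (measurableT_comp measurable_snd measurable_fst).
Qed.

Lemma measurable_incidence :
  measurable_fun setT (fun z : (Rvec R n * RR) * Rvec R n => (hp z.1 z.2, z.1)).
Proof.
apply: measurable_fun_pair; first exact: measurable_hyperplane_point.
exact: measurable_fst.
Qed.

Lemma measurable_dual_incidence :
  measurable_fun setT (fun z : Rvec R n.+1 * Rvec R n =>
    (z.1, (z.2, offset z.1 z.2 : RR))).
Proof.
apply: measurable_fun_pair; first exact: measurable_fst.
apply: measurable_fun_pair; first exact: measurable_snd.
apply: measurable_funB.
  exact: (measurableT_comp (@measurable_vlast R n) measurable_fst).
apply: measurable_dot; first exact: measurable_snd.
exact: (measurableT_comp (@measurable_vinit R n) measurable_fst).
Qed.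

(** Both sides integrate over incident pairs of a point and a hyperplane, parametrized by
    [(a, b, x')] or by [(x', t, a)] with [t = a . x' + b]. Since [g] sees the point and the
    hyperplane, the statement serves both the pairing and the null sets. *)
Lemma ge0_radon_duality (g : Rvec R n.+1 * (Rvec R n * RR) -> \bar R) :
  measurable_fun setT g -> (forall z, 0 <= g z)%E ->
  (\int[nu]_ab \int[leb]_x' g (hp ab x', ab) =
   \int[mu]_x \int[leb]_a g (x, (a, offset x a)))%E.
Proof.
move=> mg g0.
have m1 : measurable_fun setT (fun z : (Rvec R n * RR) * Rvec R n => g (hp z.1 z.2, z.1)).
  exact: (measurableT_comp mg measurable_incidence).
have m2 : measurable_fun setT
    (fun z : Rvec R n.+1 * Rvec R n => g (z.1, (z.2, offset z.1 z.2))).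
  exact: (measurableT_comp mg measurable_dual_incidence).
have mF := measurable_fun_fubini_tonelli_F (m2 := leb) _ m1 (fun z => g0 _).
rewrite fubini_tonelli1//; last by move=> z; apply: integral_ge0.
have mG := measurable_fun_fubini_tonelli_F (m2 := leb) _ m2 (fun z => g0 _).
rewrite [RHS](ge0_integral_vecS mG); last by move=> z; apply: integral_ge0.
(* The common integrand in the coordinates [a], [x'] and [t]. *)
pose K a x' (t : RR) := g (adjoin (m := n.+1) x' t, (a, t - dot a x')).
have mK : measurable_fun setT
    (fun z : (Rvec R n * RR) * Rvec R n => K z.2 z.1.1 z.1.2).
  have mad : measurable_fun setT (fun z : (Rvec R n * RR) * Rvec R n =>
      (adjoin (m := n.+1) z.1.1 z.1.2, z.2)).
    apply: measurable_fun_pair; last exact: measurable_snd.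
    exact: (measurableT_comp (@measurable_adjoin R n.+1) measurable_fst).
  rewrite (_ : (fun z => _) = (fun z : Rvec R n.+1 * Rvec R n =>
      g (z.1, (z.2, offset z.1 z.2))) \o (fun z : (Rvec R n * RR) * Rvec R n =>
      (adjoin (m := n.+1) z.1.1 z.1.2, z.2))).
    exact: (measurableT_comp m2 mad).
  by apply/funext => z; rewrite /K /= vlast_adjoin vinit_adjoin.
have K0 a x' t : (0 <= K a x' t)%E by exact: g0.
transitivity (\int[leb]_a \int[leb]_x' \int[lam]_t K a x' t)%E.
  apply: eq_integral => a _; rewrite /fubini_F.
  have m1a : measurable_fun setT
      (fun z : RR * Rvec R n => g (hp (a, z.1) z.2, (a, z.1))).
    have mz : measurable_fun setT (fun z : RR * Rvec R n => ((a, z.1), z.2)).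
      apply: measurable_fun_pair; last exact: measurable_snd.
      by apply: measurable_fun_pair; [exact: measurable_cst|exact: measurable_fst].
    exact: (measurableT_comp m1 mz).
  rewrite (fubini_tonelli (m1 := lam) (m2 := leb) _ m1a (fun z => g0 _))/=.
  apply: eq_integral => x' _.
  have mKa : measurable_fun setT (K a x').
    have mz : measurable_fun setT (fun t : RR => ((x', t), a)).
      apply: measurable_fun_pair; last exact: measurable_cst.
      by apply: measurable_fun_pair; [exact: measurable_cst|exact: measurable_id].
    exact: (measurableT_comp mK mz).
  (* At fixed [a] and [x'] the passage from [b] to [t] is a translation. *)
  rewrite -(@ge0_integral_affine _ 1 (dot a x') _ (oner_neq0 _) mKa)//.
  apply: eq_integral => b _.
  by rewrite normr1 mule1 mul1r /K /hyperplane_point/= addrK [b + _]addrC.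
transitivity (\int[leb]_x' \int[leb]_a \int[lam]_t K a x' t)%E.
  have mKt : measurable_fun setT
      (fun z : (Rvec R n * Rvec R n) * RR => K z.1.1 z.1.2 z.2).
    have mz : measurable_fun setT (fun z : (Rvec R n * Rvec R n) * RR =>
        ((z.1.2, z.2), z.1.1)).
      apply: measurable_fun_pair.
        apply: measurable_fun_pair; last exact: measurable_snd.
        exact: (measurableT_comp measurable_snd measurable_fst).
      exact: (measurableT_comp measurable_fst measurable_fst).
    exact: (measurableT_comp mK mz).
  have mKf := measurable_fun_fubini_tonelli_F (m2 := lam) _ mKt (fun z => K0 _ _ _).
  apply: (fubini_tonelli (m1 := leb) (m2 := leb) _ mKf) => z.
  by apply: integral_ge0.
apply: eq_integral => x' _.
have mKx : measurable_fun setT (fun z : Rvec R n * RR => K z.1 x' z.2).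
  have mz : measurable_fun setT (fun z : Rvec R n * RR => ((x', z.2), z.1)).
    apply: measurable_fun_pair; last exact: measurable_fst.
    by apply: measurable_fun_pair; [exact: measurable_cst|exact: measurable_snd].
  exact: (measurableT_comp mK mz).
apply: etrans (fubini_tonelli (m1 := leb) (m2 := lam) _ mKx (fun z => K0 _ _ _)) _.
apply: eq_integral => t _; rewrite /fubini_F/=; apply: eq_integral => a _.
by rewrite /K vlast_adjoin vinit_adjoin.
Qed.

(** [ge0_radon_duality] for the indicator of the exceptional set: its right side vanishes, so the
    sections along almost all hyperplanes are null. *)
Lemma ae_hyperplane_eq (T : Type) (f f0 : Rvec R n.+1 -> T) :
  {ae mu, forall x, f x = f0 x} ->
  {ae nu, forall ab, {ae leb, forall x', f (hp ab x') = f0 (hp ab x')}}.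
Proof.
move=> [N [mN N0 fN]].
have mind : measurable_fun setT (fun z : Rvec R n.+1 * (Rvec R n * RR) =>
    (\1_N z.1 : R)%:E).
  apply/measurable_EFinP; exact: (measurableT_comp (measurable_indic mN) measurable_fst).
have ind0 (z : Rvec R n.+1 * (Rvec R n * RR)) : (0 <= (\1_N z.1 : R)%:E)%E.
  by rewrite lee_fin indicE.
have H := ge0_radon_duality mind ind0.
have : (\int[nu]_ab \int[leb]_x' (\1_N (hp ab x') : R)%:E = 0)%E.
  rewrite H (@integral_eq_off_null _ _ _ _ _ (cst 0)%E N)//; first exact: integral0.
  by move=> x Nx /=; apply: integral0_eq => a _; rewrite indicE memNset.
have m1 : measurable_fun setT (fun z : (Rvec R n * RR) * Rvec R n => (\1_N (hp z.1 z.2) : R)%:E).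
  exact: (measurableT_comp mind measurable_incidence).
have mF := measurable_fun_fubini_tonelli_F (m2 := leb) _ m1 (fun z => ind0 (hp z.1 z.2, z.1)).
move=> I0.
have : (\int[nu]_ab `|\int[leb]_x' (\1_N (hp ab x') : R)%:E| = 0)%E.
  rewrite -[RHS]I0; apply: eq_integral => ab _; rewrite gee0_abs//.
  by apply: integral_ge0 => x' _; exact: (ind0 (hp ab x', ab)).
move=> /(ae_eq_integral_abs nu measurableT mF).1; apply: filterS => ab /= /(_ I) Iab.
have mhp : measurable_fun setT (hp ab).
  exact: (measurableT_comp measurable_hyperplane_point (measurable_pair1 ab)).
have mpre : measurable ((hp ab) @^-1` N).
  by rewrite -[X in measurable X]setTI; exact: mhp.
exists ((hp ab) @^-1` N); split => //.
  have := integral_indic leb measurableT mpre; rewrite setIT => <-.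
  by rewrite -[RHS]Iab; apply: eq_integral => x' _; rewrite !indicE.
by move=> x' /= ne; apply: fN.
Qed.

End radon_duality.

(** * Duality for Borel functions *)

Section duality.
Variables (R : realType) (n : nat).
Local Notation RR := (measurableTypeR R).
Local Notation lam := (@lebesgue_measure R).
Local Notation leb := (lebesgue_vec R n).
Local Notation mu := (lebesgue_vec R n.+1).
Local Notation nu := (lebesgue_vec R n \x @lebesgue_measure R)%E.
Local Notation hp := (@hyperplane_point R n.+1).
Local Notation offset x a := (vlast x - dot a (vinit x)).

Lemma sigma_finite_lebesgue_prod : sigma_finite setT nu.
Proof.
have /sigma_finiteP[F [TF _ Foo]] := sigma_finiteT (lebesgue_vec R n.+1).
have ma := @measurable_adjoin R n.+1.
exists (fun i => (fun p : Rvec R n * RR => adjoin (m := n.+1) p.1 p.2) @^-1` F i).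
  by rewrite -preimage_bigcup -TF preimage_setT.
move=> i; have [mF Fi] := Foo i; split => //.
by rewrite -[X in measurable X]setTI; exact: ma.
Qed.

(* Canonical inference on a product of measures only finds its
   sub-probability structure, hence this explicit packing. *)
Definition lebesgue_prod : {sigma_finite_measure set (Rvec R n * RR)%type -> \bar R} :=
  HB.pack nu (Measure_isSigmaFinite.Build _ _ _ nu sigma_finite_lebesgue_prod).

Section borel.
Variables (f w : Rvec R n.+1 -> R[i]) (u : Rvec R n * RR -> R[i]).
Variables (c : R[i]) (c0 : R).
Hypotheses (mf : complex_measurable f) (mw : complex_measurable w)
  (mu_ : complex_measurable u).
Hypothesis c0_gt0 : 0 < c0.
Hypothesis u_abs : forall x, (\int[leb]_a (normc (u (a, offset x a)))%:E =
  (c0 * normc (w x))%:E)%E.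
Hypothesis u_int : forall x,
  cintegral leb setT (fun a => u (a, (offset x a : RR))) = c * w x.
Hypothesis u_neq0 : {ae nu, forall ab, u ab != 0}.

Lemma complex_measurable_hyperplane_fun ab :
  complex_measurable (fun x' => f (hp ab x')).
Proof.
apply: (complex_measurable_comp _ mf).
exact: (measurableT_comp (@measurable_hyperplane_point R n) (measurable_pair1 ab)).
Qed.

Lemma complex_measurable_incident :
  complex_measurable (fun z : (Rvec R n * RR) * Rvec R n => f (hp z.1 z.2)).
Proof. exact: complex_measurable_comp (@measurable_hyperplane_point R n) mf. Qed.

Lemma measurable_RT_abs : measurable_fun setT (RT_abs (m := n.+1) f).
Proof.
have mN : measurable_fun setT (fun z : (Rvec R n * RR) * Rvec R n =>
    (normc (f (hp z.1 z.2)))%:E).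
  apply/measurable_EFinP; exact: complex_measurable_normc complex_measurable_incident.
apply: (measurable_fun_fubini_tonelli_F (m2 := leb) _ mN) => z.
by rewrite lee_fin normc_ge0.
Qed.

Lemma RT_abs_ge0 (g : Rvec R n.+1 -> R[i]) ab : (0 <= RT_abs (m := n.+1) g ab)%E.
Proof. by apply: integral_ge0 => x' _; rewrite lee_fin normc_ge0. Qed.

(** An identity in [[0, +oo]]. As [c0] is positive and finite, it makes the two alternatives in the
    premise of [duality_identity] equivalent. *)
Lemma RT_abs_duality :
  (\int[nu]_ab (RT_abs (m := n.+1) f ab * (normc (u ab))%:E) =
   c0%:E * \int[mu]_x (normc (f x * w x))%:E)%E.
Proof.
have mfN := complex_measurable_normc mf; have muN := complex_measurable_normc mu_.
have mg : measurable_fun setT (fun z : Rvec R n.+1 * (Rvec R n * RR) =>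
    (normc (f z.1) * normc (u z.2))%:E).
  apply/measurable_EFinP; apply: measurable_funM.
    exact: (measurableT_comp mfN measurable_fst).
  exact: (measurableT_comp muN measurable_snd).
have g0 (z : Rvec R n.+1 * (Rvec R n * RR)) : (0 <= (normc (f z.1) * normc (u z.2))%:E)%E.
  by rewrite lee_fin mulr_ge0 ?normc_ge0.
transitivity (\int[nu]_ab \int[leb]_x' (normc (f (hp ab x')) * normc (u ab))%:E)%E.
  apply: eq_integral => ab _; rewrite /RT_abs.
  have mfa : measurable_fun setT (fun x' => (normc (f (hp ab x')))%:E).
    apply/measurable_EFinP.
    exact: complex_measurable_normc (complex_measurable_hyperplane_fun ab).
  apply/esym; under eq_integral do rewrite EFinM.
  apply: (ge0_integralZr leb measurableT mfa); last by rewrite lee_fin normc_ge0.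
  by move=> x' _; rewrite lee_fin normc_ge0.
apply: etrans (ge0_radon_duality mg g0) _.
have mfw : measurable_fun setT (fun x => (normc (f x * w x))%:E).
  by apply/measurable_EFinP; apply: complex_measurable_normc; exact: complex_measurableM.
transitivity (\int[mu]_x (c0%:E * (normc (f x * w x))%:E))%E; last first.
  apply: (ge0_integralZl mu measurableT mfw); last by rewrite lee_fin ltW.
  by move=> x _; rewrite lee_fin normc_ge0.
apply: eq_integral => x _.
have mua : measurable_fun setT (fun a => (normc (u (a, (offset x a : RR))))%:E).
  apply/measurable_EFinP.
  apply: (measurableT_comp muN); apply: measurable_fun_pair; first exact: measurable_id.
  exact: measurable_offset.
transitivity ((normc (f x))%:E * \int[leb]_a (normc (u (a, offset x a)))%:E)%E.
  under eq_integral do rewrite /= EFinM.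
  apply: (ge0_integralZl leb measurableT mua); last by rewrite lee_fin normc_ge0.
  by move=> a _; rewrite lee_fin normc_ge0.
by rewrite u_abs -!EFinM normcM; congr _%:E; ring.
Qed.

Hypothesis fwoo : (\int[mu]_x (normc (f x * w x))%:E < +oo)%E.

Lemma RT_abs_weight_lty :
  (\int[nu]_ab (RT_abs (m := n.+1) f ab * (normc (u ab))%:E) < +oo)%E.
Proof. by rewrite RT_abs_duality lte_mul_pinfty// ?lee_fin ?ltW. Qed.

(** An integrable product is finite almost everywhere, and a nonzero factor [u ab] cannot hide an
    infinite [RT_abs f ab]. *)
Lemma RT_abs_ae_lty : {ae nu, forall ab, (RT_abs (m := n.+1) f ab < +oo)%E}.
Proof.
have muN : measurable_fun setT (fun ab => (normc (u ab))%:E).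
  by apply/measurable_EFinP; exact: complex_measurable_normc.
have i : nu.-integrable setT
    (fun ab => RT_abs (m := n.+1) f ab * (normc (u ab))%:E)%E.
  apply/integrableP; split.
    by apply: emeasurable_funM => //; exact: measurable_RT_abs.
  apply: le_lt_trans RT_abs_weight_lty; rewrite le_eqVlt; apply/orP; left.
  apply/eqP; apply: eq_integral => ab _; rewrite gee0_abs// mule_ge0 ?RT_abs_ge0//.
  by rewrite lee_fin normc_ge0.
apply: filterS2 (integrable_ae measurableT i) u_neq0 => ab /(_ I) fin u0.
have un0 := normc_gt0 u0; rewrite ltNge leye_eq; apply/negP => /eqP Roo.
by move: fin; rewrite Roo mulyr gtr0_sg// mul1e.
Qed.

Lemma complex_measurable_RT : complex_measurable (RT (m := n.+1) f).
Proof.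
exact: (complex_measurable_cintegral leb complex_measurable_incident).
Qed.

Lemma normc_RT_weight_lty : (\int[nu]_ab (normc (RT (m := n.+1) f ab * u ab))%:E < +oo)%E.
Proof.
have mRT := complex_measurable_RT.
have muN := complex_measurable_normc mu_.
have mRu : measurable_fun setT (fun ab => (RT_abs (m := n.+1) f ab * (normc (u ab))%:E)%E).
  by apply: emeasurable_funM; [exact: measurable_RT_abs|exact/measurable_EFinP].
have Ru0 ab : (0 <= RT_abs (m := n.+1) f ab * (normc (u ab))%:E)%E.
  by rewrite mule_ge0 ?RT_abs_ge0// lee_fin normc_ge0.
have : (2%:E * \int[nu]_ab (RT_abs (m := n.+1) f ab * (normc (u ab))%:E) < +oo)%E.
  by rewrite lte_mul_pinfty ?RT_abs_weight_lty// lee_fin.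
apply: le_lt_trans; rewrite -ge0_integralZl//.
apply: ae_ge0_le_integral => //.
- by move=> ab _; rewrite lee_fin normc_ge0.
- by apply/measurable_EFinP; apply: complex_measurable_normc; exact: complex_measurableM.
- by move=> ab _; rewrite mule_ge0.
- exact: measurable_funeM.
(* [normc_cintegral_le] needs [f] to be integrable on the hyperplane, so the comparison holds almost
   everywhere only. *)
apply: filterS RT_abs_ae_lty => ab fin _.
rewrite normcM EFinM muleA lee_wpmul2r ?lee_fin ?normc_ge0//.
exact: (normc_cintegral_le (complex_measurable_hyperplane_fun ab)).
Qed.

(** Fubini on either side of a transfer: [ge0_radon_duality] identifies the two product integrals
    over incident pairs, and the integral over [a] that remains at fixed [x] is the kernel. *)
Lemma cintegral_duality :
  cintegral nu setT (fun ab => RT (m := n.+1) f ab * u ab) =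
  c * cintegral mu setT (fun x => f x * w x).
Proof.
have mg : complex_measurable (fun z : Rvec R n.+1 * (Rvec R n * RR) => f z.1 * u z.2).
  apply: complex_measurableM; first exact: (complex_measurable_comp measurable_fst mf).
  exact: (complex_measurable_comp measurable_snd mu_).
have mF1 : complex_measurable (fun z : (Rvec R n * RR) * Rvec R n => f (hp z.1 z.2) * u z.1).
  exact: (complex_measurable_comp (@measurable_incidence R n) mg).
have mF2 : complex_measurable (fun z : Rvec R n.+1 * Rvec R n =>
    f z.1 * u (z.2, (offset z.1 z.2 : RR))).
  exact: (complex_measurable_comp (@measurable_dual_incidence R n) mg).
(* The constant [u ab] enters the inner integral where that integral converges absolutely. *)
transitivity (cintegral nu setT (fun ab =>
    cintegral leb setT (fun x' => f (hp ab x') * u ab))).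
  apply: eq_cintegral_ae; apply: filterS RT_abs_ae_lty => ab fin.
  rewrite mulrC -(cintegralZl _ (complex_measurable_hyperplane_fun ab) fin).
  by congr cintegral; apply/funext => x'; rewrite mulrC.
have F1oo : (\int[nu]_ab \int[leb]_x' (normc (f (hp ab x') * u ab))%:E < +oo)%E.
  apply: le_lt_trans RT_abs_weight_lty; rewrite le_eqVlt; apply/orP; left; apply/eqP.
  apply: eq_integral => ab _; under eq_integral do rewrite normcM EFinM.
  have mfa : measurable_fun setT (fun x' => (normc (f (hp ab x')))%:E).
    apply/measurable_EFinP.
    exact: complex_measurable_normc (complex_measurable_hyperplane_fun ab).
  apply: (ge0_integralZr leb measurableT mfa); last by rewrite lee_fin normc_ge0.
  by move=> x' _; rewrite lee_fin normc_ge0.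
apply: etrans (cintegral_fubini1 (m1 := lebesgue_prod) (m2 := leb) mF1 F1oo) _.
have hyp (g : Rvec R n.+1 * (Rvec R n * RR) -> \bar R) :
    measurable_fun setT g -> (forall z, 0 <= g z)%E ->
    (\int[lebesgue_prod \x leb]_z (g (hp z.1 z.2, z.1) * 1%:E) =
     \int[mu \x leb]_z (g (z.1, (z.2, offset z.1 z.2)) * 1%:E))%E.
  move=> m_g g0; under eq_integral do rewrite mule1.
  under [RHS]eq_integral do rewrite mule1.
  have m1 := measurableT_comp m_g (@measurable_incidence R n).
  have m2 := measurableT_comp m_g (@measurable_dual_incidence R n).
  apply: etrans (fubini_tonelli1 (m1 := lebesgue_prod) (m2 := leb) _ m1 (fun z => g0 _)) _.
  apply: etrans (ge0_radon_duality m_g g0) _.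
  exact/esym/(fubini_tonelli1 (m1 := mu) (m2 := leb) _ m2 (fun z => g0 _)).
have T := cintegral_transfer (mu := (lebesgue_prod \x leb)%E) (nu := (mu \x leb)%E)
  (phi := fun z : (Rvec R n * RR) * Rvec R n => (hp z.1 z.2, z.1))
  (psi := fun z : Rvec R n.+1 * Rvec R n => (z.1, (z.2, offset z.1 z.2 : RR)))
  (v := fun=> 1) (w := fun=> 1) (fun=> ler01) (fun=> ler01) hyp mg.
transitivity (cintegral (mu \x leb)%E setT (fun z : Rvec R n.+1 * Rvec R n =>
    f z.1 * u (z.2, (offset z.1 z.2 : RR)))).
  rewrite (_ : (fun z => f (hp z.1 z.2) * u z.1) =
      fun z => f (hp z.1 z.2) * u z.1 * (1 : R)%:C); last first.
    by apply/funext => z; rewrite mulr1.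
  rewrite T; congr cintegral; apply/funext => z; by rewrite mulr1.
have mua x : complex_measurable (fun a => u (a, (offset x a : RR))).
  apply: (complex_measurable_comp _ mu_).
  apply: measurable_fun_pair; first exact: measurable_id.
  exact: measurable_offset.
have uoo x : (\int[leb]_a (normc (u (a, offset x a)))%:E < +oo)%E.
  by rewrite u_abs ltry.
(* By [u_abs] the inner integral is [c0] times the modulus of [f x * w x]. *)
have F2oo : (\int[mu]_x \int[leb]_a (normc (f x * u (a, offset x a)))%:E < +oo)%E.
  have : (c0%:E * \int[mu]_x (normc (f x * w x))%:E < +oo)%E.
    by rewrite lte_mul_pinfty// ?lee_fin ?ltW.
  have mfw : measurable_fun setT (fun x => (normc (f x * w x))%:E).
    by apply/measurable_EFinP; apply: complex_measurable_normc; exact: complex_measurableM.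
  rewrite -(ge0_integralZl mu measurableT mfw); last 2 first.
  - by move=> x _; rewrite lee_fin normc_ge0.
  - by rewrite lee_fin ltW.
  apply: le_lt_trans; rewrite le_eqVlt; apply/orP; left; apply/eqP.
  apply: eq_integral => x _; under eq_integral do rewrite normcM EFinM.
  have muN : measurable_fun setT (fun a => (normc (u (a, (offset x a : RR))))%:E).
    by apply/measurable_EFinP; exact: complex_measurable_normc.
  apply: etrans (ge0_integralZl leb measurableT muN _ _) _.
  - by move=> a _; rewrite lee_fin normc_ge0.
  - by rewrite lee_fin normc_ge0.
  by rewrite u_abs -!EFinM normcM; congr _%:E; ring.
apply: etrans (esym (cintegral_fubini1 (m1 := mu) (m2 := leb) mF2 F2oo)) _.
rewrite -(cintegralZl _ (complex_measurableM mf mw) fwoo).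
congr cintegral; apply/funext => x.
by rewrite /= (cintegralZl _ (mua x) (uoo x)) u_int; ring.
Qed.

End borel.
End duality.

(** * Passage to Lebesgue measurable functions *)

Section duality_ae.
Variables (R : realType) (n : nat).
Local Notation RR := (measurableTypeR R).
Local Notation leb := (lebesgue_vec R n).
Local Notation mu := (lebesgue_vec R n.+1).
Local Notation nu := (lebesgue_vec R n \x @lebesgue_measure R)%E.
Local Notation hp := (@hyperplane_point R n.+1).
Local Notation offset x a := (vlast x - dot a (vinit x)).

(** Every clause of [duality_identity] depends only on almost everywhere classes; for the values of
    [RT] this is [ae_hyperplane_eq]. The weights may thus be replaced by [u0] and [w0], for which
    the kernel identities hold at every point. *)
Lemma duality_identity_ae (f w w0 : Rvec R n.+1 -> R[i])
    (u u0 : Rvec R n * RR -> R[i]) (c : R[i]) (c0 : R) :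
  cmeasurable mu f -> complex_measurable w0 -> complex_measurable u0 -> 0 < c0 ->
  (forall x, (\int[leb]_a (normc (u0 (a, offset x a)))%:E =
    (c0 * normc (w0 x))%:E)%E) ->
  (forall x, cintegral leb setT (fun a => u0 (a, (offset x a : RR))) = c * w0 x) ->
  {ae nu, forall ab, u0 ab != 0} ->
  {ae nu, forall ab, u ab = u0 ab} -> {ae mu, forall x, w x = w0 x} ->
  duality_identity (m := n.+1) f c u w.
Proof.
move=> mf mw0 mu0 c0_gt0 u_abs u_int u_neq0 uu0 ww0.
have [f0 mf0 ff0] := cmeasurable_borel mf.
have hff0 := ae_hyperplane_eq ff0.
have RTE : {ae nu, forall ab, RT (m := n.+1) f ab * u ab = RT (m := n.+1) f0 ab * u0 ab}.
  by apply: filterS2 hff0 uu0 => ab /eq_cintegral_ae E ->; congr (_ * _).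
have RT_absE : {ae nu, forall ab, (RT_abs (m := n.+1) f ab * (normc (u ab))%:E =
    RT_abs (m := n.+1) f0 ab * (normc (u0 ab))%:E)%E}.
  by apply: filterS2 hff0 uu0 => ab /eq_integral_normc_ae E ->; congr (_ * _)%E.
have fwE : {ae mu, forall x, f x * w x = f0 x * w0 x}.
  by apply: filterS2 ff0 ww0 => x -> ->.
move=> /= H.
have fwoo : (\int[mu]_x (normc (f0 x * w0 x))%:E < +oo)%E.
  (* A finite pairing on the hyperplane side excludes an infinite one on the point side, because
     [c0] is positive. *)
  case: H => [|]; last by rewrite (eq_integral_normc_ae fwE).
  rewrite (eq_integral_ae RT_absE) (RT_abs_duality mf0 mw0 mu0 c0_gt0 u_abs).
  rewrite !ltNge !leye_eq; apply: contra => /eqP ->.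
  by rewrite gt0_muley// lte_fin.
have RToo := RT_abs_ae_lty mf0 mw0 mu0 c0_gt0 u_abs u_neq0 fwoo.
split.
- apply: filterS2 hff0 RToo => ab E fin.
  exact: cintegrable_ae_eq (complex_measurable_hyperplane_fun mf0 ab) fin E.
- apply: cintegrable_ae_eq RTE.
    exact: complex_measurableM (complex_measurable_RT mf0) mu0.
  exact: normc_RT_weight_lty mf0 mw0 mu0 c0_gt0 u_abs u_neq0 fwoo.
- exact: cintegrable_ae_eq (complex_measurableM mf0 mw0) fwoo fwE.
rewrite (eq_cintegral_ae RTE) (eq_cintegral_ae fwE).
exact: cintegral_duality mf0 mw0 mu0 c0_gt0 u_abs u_int u_neq0 fwoo.
Qed.

Lemma ae_offset_neq0 : {ae nu, forall ab : Rvec R n * RR, ab.2 != 0}.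
Proof.
have m0 : measurable ([set 0] : set RR) by exact: measurable_set1.
exists (setT `*` [set 0]); split; first exact: measurableX.
  rewrite product_measure1E//; rewrite [X in (_ * X)%E](_ : _ = 0%E) ?mule0//.
  exact: lebesgue_measure_set1.
by move=> [a b] /= /negP; rewrite negbK => /eqP ->.
Qed.

(** The origin is enclosed in the hyperplane of vanishing last coordinate, whose measure is read off
    the product structure. *)
Lemma ae_dot_gt0 : {ae mu, forall x, 0 < dot x x}.
Proof.
have m0 : measurable ([set 0] : set RR) by exact: measurable_set1.
exists (@vlast R n @^-1` [set 0]); split.
- by rewrite -[X in measurable X]setTI; exact: measurable_vlast.
- rewrite /= /pushforward.
  rewrite (_ : _ @^-1` _ = setT `*` [set 0]); last first.
    by apply/seteqP; split => -[a b] /=; rewrite vlast_adjoin; [split|case].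
  rewrite product_measure1E//; rewrite [X in (_ * X)%E](_ : _ = 0%E) ?mule0//.
  exact: lebesgue_measure_set1.
move=> x /= /negP; rewrite -leNgt => d0; apply/eqP; move: d0; apply: contraTT => v0.
rewrite -ltNge -(adjoin_vinit_vlast x) dot_adjoin ltr_pwDr ?dot_ge0//.
by rewrite -expr2 exprn_even_gt0.
Qed.

End duality_ae.

(** * The kernels as quotients of powers *)

Section power_kernels.
Variables (R : realType) (n : nat) (eps : R) (alpha : R[i]).
Hypotheses (eps0 : 0 <= eps) (ha : 0 < complex.Re alpha).
Local Notation RR := (measurableTypeR R).
Local Notation leb := (lebesgue_vec R n).
Local Notation mu := (lebesgue_vec R n.+1).
Local Notation nu := (lebesgue_vec R n \x @lebesgue_measure R)%E.

Lemma abs_cpowV z (r : R) : 0 < r -> abs_cpow z r^-1 = (cpow r z)^-1.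
Proof.
move=> r0; have c0 := cpow_neq0 z r0; apply: (mulfI c0); rewrite mulfV//.
rewrite -(abs_cpow_gt0 z r0) -abs_cpowM mulfV ?gt_eqF//.
by rewrite abs_cpow_gt0// cpow1l.
Qed.

(** In terms of the square root [hw] of the base the exponent doubles to [(alpha - 1) + (n + 1)]. At
    [b = 0] the two sides can differ: if [alpha] has real part 1, [cpow] takes the value 1 there and
    [abs_cpow] the value 0. *)
Lemma hyperplane_kernelE (a : Rvec R n) (b : R) : b != 0 ->
  hyperplane_kernel eps alpha (a, b) = cpow `|b| (alpha - 1) /
    cpow (1 + enorm a ^+ 2 + eps * b ^+ 2) ((alpha + n.+1%:R - 1) / 2).
Proof.
move=> b0; have s0 := hyperplane_weight_gt0 eps0 a b.
rewrite enorm_sqr -hyperplane_weight_sqr// cpow_sqr// [2 * _]mulrC divfK ?pnatr_eq0//.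
rewrite addrAC (cpowD _ _ s0) (cpow_nat _ s0) /hyperplane_kernel/=.
rewrite abs_cpowM abs_cpowV// /abs_cpow (negbTE b0) fmorphV.
by rewrite -mulrA -(invfM (cpow _ _)).
Qed.

(** The doubled exponent [alpha] splits as [(alpha - 1) + 1], matching the two factors of
    [point_kernel]. *)
Lemma point_kernelE (x : Rvec R n.+1) : 0 < dot x x ->
  point_kernel eps alpha x =
    cpow (enorm x) (alpha - 1) / cpow (1 + eps * enorm x ^+ 2) (alpha / 2).
Proof.
move=> x0; have e0 : 0 < enorm x by rewrite sqrtr_gt0.
have q0 : 0 < 1 + eps * dot x x by rewrite ltr_pwDl// mulr_ge0 ?dot_ge0.
have t0 : 0 < Num.sqrt (1 + eps * dot x x) by rewrite sqrtr_gt0.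
rewrite enorm_sqr -{1}(sqr_sqrtr (ltW q0)) cpow_sqr// [2 * _]mulrC divfK ?pnatr_eq0//.
have -> : cpow (Num.sqrt (1 + eps * dot x x)) alpha =
    cpow (Num.sqrt (1 + eps * dot x x)) (alpha - 1) * (Num.sqrt (1 + eps * dot x x))%:C.
  by rewrite -(cpow1 t0) -(cpowD _ _ t0) subrK.
rewrite /point_kernel /point_weight abs_cpowM abs_cpowV// abs_cpow_gt0// fmorphV.
by rewrite -mulrA -(invfM (cpow _ _)).
Qed.

Lemma duality_identity_power (f : Rvec R n.+1 -> R[i]) : cmeasurable mu f ->
  duality_identity (m := n.+1) f (radon_lambda n.+1 alpha)
    (fun ab => cpow `|ab.2| (alpha - 1) /
       cpow (1 + enorm ab.1 ^+ 2 + eps * ab.2 ^+ 2) ((alpha + n.+1%:R - 1) / 2))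
    (fun x => cpow (enorm x) (alpha - 1) /
       cpow (1 + eps * enorm x ^+ 2) (alpha / 2)).
Proof.
move=> mf.
have uE : {ae nu, forall ab : Rvec R n * RR, cpow `|ab.2| (alpha - 1) /
    cpow (1 + enorm ab.1 ^+ 2 + eps * ab.2 ^+ 2) ((alpha + n.+1%:R - 1) / 2) =
    hyperplane_kernel eps alpha ab}.
  by apply: filterS (ae_offset_neq0 R n) => -[a b] b0; rewrite hyperplane_kernelE.
refine (duality_identity_ae mf (complex_measurable_point_kernel n eps alpha)
  (complex_measurable_hyperplane_kernel n alpha eps0)
  (abs_kernel_constant_gt0 n ha) _ _ _ uE _).
- move=> x; rewrite (integral_normc_hyperplane_kernel eps0 ha).
  by rewrite adjoin_vinit_vlast.
- move=> x; rewrite (cintegral_hyperplane_kernel eps0 ha).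
  by rewrite adjoin_vinit_vlast.
- apply: filterS (ae_offset_neq0 R n) => -[a b] /= b0.
  rewrite hyperplane_kernelE// mulf_neq0 ?invr_eq0 ?cpow_neq0 ?normr_gt0//.
  by rewrite enorm_sqr -(hyperplane_weight_sqr eps0) exprn_gt0// hyperplane_weight_gt0.
by apply: filterS (@ae_dot_gt0 R n) => x x0; rewrite point_kernelE.
Qed.

End power_kernels.

Lemma eq_duality_identity (R : realType) (m : nat) (f : Rvec R m -> R[i]) c
    u u' w w' : u =1 u' -> w =1 w' ->
  duality_identity f c u w -> duality_identity f c u' w'.
Proof. by move=> /funext -> /funext ->. Qed.

Theorem theorem1p1 (R : realType) (m : nat) (hm : (2 <= m)%N)
    (alpha : R[i]) (halpha : 0 < complex.Re alpha)
    (f : Rvec R m -> R[i]) (hf : cmeasurable (lebesgue_vec R m) f) :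
  duality_identity f (radon_lambda m alpha)
    (fun ab => cpow `|ab.2| (alpha - 1)
       / cpow (1 + enorm ab.1 ^+ 2) ((alpha + m%:R - 1) / 2))
    (fun x => cpow (enorm x) (alpha - 1)) /\
  duality_identity f (radon_lambda m alpha)
    (fun ab => cpow `|ab.2| (alpha - 1)
       / cpow (1 + enorm ab.1 ^+ 2 + ab.2 ^+ 2) ((alpha + m%:R - 1) / 2))
    (fun x => cpow (enorm x) (alpha - 1)
       / cpow (1 + enorm x ^+ 2) (alpha / 2)).
Proof.
case: m hm f hf => // n _ f hf; split.
  (* For [eps = 0] the denominator of the point weight is a power of 1. *)
  apply: eq_duality_identity (duality_identity_power (lexx 0) halpha hf) => [ab|x].
    by rewrite mul0r addr0.
  by rewrite mul0r addr0 cpow1l divr1.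
by apply: eq_duality_identity (duality_identity_power ler01 halpha hf) => ?;
  rewrite mul1r.
Qed.
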